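(* Let $k\geq 2$, $p\geq k$ and $q>p$ be integers. Then on every instance $I$ of $\mathsf{k\,CSP\!-\!q}$, the differential ratio of the best solutions among those whose coordinates take at most $p$ distinct values is at least $$\gamma:=\frac{2}{\sum_{r=0}^k\binom{q-p+k}{r}\binom{q-p+k-1-r}{k-r}+1}\ \geq\ \frac{2(k!)}{(2q-2p+k)^k}.$$ Furthermore, if $\mathsf{k\,CSP\!-\!p}$ is approximable within some differential factor $\rho$, then $\mathsf{k\,CSP\!-\!q}$ is approximable within differential factor $\gamma\times\rho$.
   Context: Let $\Sigma_q=\{0,1,\ldots,q-1\}$ and $[n]=\{1,\ldots,n\}$; $k,p,q$ are constants. An instance $I$ of $\mathsf{k\,CSP\!-\!q}$ consists of integers $n,m\ge 1$, a goal (maximize or minimize) and, for each $i\in[m]$, a weight $w_i>0$, an integer $1\le k_i\leq \min\{k,n\}$, a strictly increasing sequence $J_i=(i_1,\ldots,i_{k_i})$ of indices of $[n]$, and a function $P_i:\Sigma_q^{k_i}\to\mathbb{R}$. Solutions are vectors $x\in\Sigma_q^n$, with value $v(I,x)=\sum_{i=1}^m w_iP_i(x_{i_1},\ldots,x_{i_{k_i}})$. $\mathrm{opt}(I)$ and $\mathrm{wor}(I)$ are the best and worst solution values (maximum and minimum of $v(I,\cdot)$ if maximizing, minimum and maximum if minimizing). The differential ratio of $x$ on $I$ is $(v(I,x)-\mathrm{wor}(I))/(\mathrm{opt}(I)-\mathrm{wor}(I))$ (considered when $\mathrm{opt}(I)\neq\mathrm{wor}(I)$). A problem is approximable within differential factor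 $\rho$ if there is a polynomial-time algorithm that returns, on every instance, a solution of differential ratio at least $\rho$. *)

(* Defs.v *)
From mathcomp Require Import all_boot all_order all_algebra.
From mathcomp Require Import reals.

Set Implicit Arguments.
Unset Strict Implicit.
Unset Printing Implicit Defensive.

Import Order.TTheory GRing.Theory Num.Theory.
Local Open Scope ring_scope.

(** * Instances of k CSP-q

    The alphabet [{0, ..., q-1}] is ['I_q] and the set [{1, ..., n}] of
    variable indices is ['I_n], i.e. it is shifted to [{0, ..., n-1}]. *)

Record constraint (F : realFieldType) (k q n : nat) := Constraint {
  weight : F;
  arity : nat;
  scope : arity.-tuple 'I_n;
  func : arity.-tuple 'I_q -> F;
  weight_gt0 : 0 < weight;
  arity_bounds : (1 <= arity <= minn k n)%N;
  scope_increasing : sorted ltn [seq val i | i <- scope]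
}.
Arguments weight {F k q n} c.
Arguments arity {F k q n} c.
Arguments scope {F k q n} c.
Arguments func {F k q n} c _.

Record csp (F : realFieldType) (k q : nat) := Csp {
  nvars : nat;
  maximizing : bool; (* [false]: the goal is to minimize *)
  constraints : seq (constraint F k q nvars);
  nvars_gt0 : (0 < nvars)%N;
  constraints_gt0 : (0 < size constraints)%N
}.

Section Values.
Variables (F : realFieldType) (k q : nat) (I : csp F k q).

Definition value (x : (nvars I).-tuple 'I_q) : F :=
  \sum_(c <- constraints I) weight c * func c (map_tuple (tnth x) (scope c)).

(* The list of values is nonempty as soon as [0 < q], so that the default
   element [head 0 values] is itself a value. *)
Definition values : seq F := [seq value x | x : (nvars I).-tuple 'I_q].
Definition max_value : F := \big[Num.max/head 0 values]_(v <- values) v.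
Definition min_value : F := \big[Num.min/head 0 values]_(v <- values) v.

Definition opt : F := if maximizing I then max_value else min_value.
Definition wor : F := if maximizing I then min_value else max_value.

Definition diff_ratio (x : (nvars I).-tuple 'I_q) : F :=
  (value x - wor) / (opt - wor).

Definition at_least_as_good (x y : (nvars I).-tuple 'I_q) : bool :=
  if maximizing I then value y <= value x else value x <= value y.

Definition nb_distinct (x : (nvars I).-tuple 'I_q) : nat := size (undup x).

Definition best_with_at_most (p : nat) (x : (nvars I).-tuple 'I_q) : Prop :=
  (nb_distinct x <= p)%N /\
  (forall y, (nb_distinct y <= p)%N -> at_least_as_good x y).

End Values.

(** * A model of computation with an explicit running time

    Imperative programs over binary trees (as in N. D. Jones' WHILE language)
    whose leaves may carry numbers of a field [F].  An elementary tree
    operation costs 1, as trees are shared and never copied; an arithmetic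
    operation or a comparison costs in addition the size [sz] of each of its
    numeric operands.
    - With [F := rat] and [sz] the bit length, every number computed has a bit
      length linear in the cost of the operation that produced it, hence this
      model and Turing machines simulate each other in polynomial time.
    - With [F] the field of real numbers and [sz := 1], this is a real RAM
      with arithmetic operations and comparisons at unit cost. *)

Inductive data (F : Type) :=
  | Nil
  | Num (c : F)
  | Pair (a b : data F).
Arguments Nil {F}.

Inductive expr :=
  | EVar (x : nat)
  | ENil
  | EConst (z : int)
  | ECons (e1 e2 : expr)
  | EHd (e : expr)
  | ETl (e : expr)
  | EIsNum (e : expr)
  | EAdd (e1 e2 : expr)
  | ESub (e1 e2 : expr)
  | EMul (e1 e2 : expr)
  | EDiv (e1 e2 : expr)
  | ELe (e1 e2 : expr).

Inductive cmd :=
  | CSkip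
  | CAssign (x : nat) (e : expr)
  | CSeq (c1 c2 : cmd)
  | CIf (e : expr) (c1 c2 : cmd)
  | CWhile (e : expr) (c : cmd).

Section Machine.
Variables (F : realFieldType) (sz : F -> nat).

Definition store := nat -> data F.

Definition update (s : store) (x : nat) (d : data F) : store :=
  fun y => if y == x then d else s y.

Definition of_bool (b : bool) : data F := if b then Pair Nil Nil else Nil.

(* [Nil] is false, anything else is true *)
Definition truth (d : data F) : bool := if d is Nil then false else true.

(* Ill-typed operations return [Nil]. *)
Definition arith (op : F -> F -> data F) (a b : data F) : data F :=
  match a, b with
  | Num u, Num v => op u v
  | _, _ => Nil
  end.

Fixpoint eval (e : expr) (s : store) : data F :=
  match e with
  | EVar x => s x
  | ENil => Nil
  | EConst z => Num z%:~R
  | ECons e1 e2 => Pair (eval e1 s) (eval e2 s)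
  | EHd e => if eval e s is Pair a _ then a else Nil
  | ETl e => if eval e s is Pair _ b then b else Nil
  | EIsNum e => of_bool (if eval e s is Num _ then true else false)
  | EAdd e1 e2 => arith (fun u v => Num (u + v)) (eval e1 s) (eval e2 s)
  | ESub e1 e2 => arith (fun u v => Num (u - v)) (eval e1 s) (eval e2 s)
  | EMul e1 e2 => arith (fun u v => Num (u * v)) (eval e1 s) (eval e2 s)
  | EDiv e1 e2 => arith (fun u v => Num (u / v)) (eval e1 s) (eval e2 s)
  | ELe e1 e2 => arith (fun u v => of_bool (u <= v)) (eval e1 s) (eval e2 s)
  end.

Definition num_size (d : data F) : nat := if d is Num c then sz c else 0%N.

Fixpoint eval_cost (e : expr) (s : store) : nat :=
  match e with
  | EVar _ | ENil | EConst _ => 1%N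
  | EHd e | ETl e | EIsNum e => (1 + eval_cost e s)%N
  | ECons e1 e2 => (1 + eval_cost e1 s + eval_cost e2 s)%N
  | EAdd e1 e2 | ESub e1 e2 | EMul e1 e2 | EDiv e1 e2 | ELe e1 e2 =>
      (1 + eval_cost e1 s + eval_cost e2 s
         + num_size (eval e1 s) + num_size (eval e2 s))%N
  end.

(* [exec c s s' t]: started in store [s], the command [c] halts in store [s']
   after time [t]. *)
Inductive exec : cmd -> store -> store -> nat -> Prop :=
  | exec_skip s : exec CSkip s s 1
  | exec_assign x e s :
      exec (CAssign x e) s (update s x (eval e s)) (1 + eval_cost e s)
  | exec_seq c1 c2 s1 s2 s3 t1 t2 :
      exec c1 s1 s2 t1 -> exec c2 s2 s3 t2 ->
      exec (CSeq c1 c2) s1 s3 (t1 + t2)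
  | exec_if_true e c1 c2 s s' t :
      truth (eval e s) -> exec c1 s s' t ->
      exec (CIf e c1 c2) s s' (1 + eval_cost e s + t)
  | exec_if_false e c1 c2 s s' t :
      ~~ truth (eval e s) -> exec c2 s s' t ->
      exec (CIf e c1 c2) s s' (1 + eval_cost e s + t)
  | exec_while_true e c s1 s2 s3 t1 t2 :
      truth (eval e s1) -> exec c s1 s2 t1 -> exec (CWhile e c) s2 s3 t2 ->
      exec (CWhile e c) s1 s3 (1 + eval_cost e s1 + t1 + t2)
  | exec_while_false e c s :
      ~~ truth (eval e s) -> exec (CWhile e c) s s (1 + eval_cost e s).

Fixpoint data_size (d : data F) : nat :=
  match d with
  | Nil => 1%N
  | Num c => (1 + sz c)%N
  | Pair a b => (1 + data_size a + data_size b)%N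
  end.

(* Variable 0 holds the input, and the output on termination. *)
Definition input_store (d : data F) : store := update (fun=> Nil) 0%N d.

End Machine.

(** * Encoding of instances and solutions *)

Section Encoding.
Variable F : realFieldType.

Definition enc_seq (s : seq (data F)) : data F := foldr (@Pair F) Nil s.

Definition enc_nat (n : nat) : data F := Num n%:R.

(* A function is given by the table of its values, in the order of [enum]. *)
Definition enc_constraint k q n (c : constraint F k q n) : data F :=
  enc_seq [:: Num (weight c);
              enc_seq [seq enc_nat i | i : 'I_n <- scope c];
              enc_seq [seq Num (func c t) | t : (arity c).-tuple 'I_q]].

(* The variables are listed, so that the size of an instance is at least the
   length of its solutions; [k] and [q] are constants of the problem and are not
   part of the input. *)
Definition enc_csp k q (I : csp F k q) : data F :=
  enc_seq [:: of_bool F (maximizing I);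
              enc_seq [seq enc_nat i | i : 'I_(nvars I)];
              enc_seq [seq enc_constraint c | c <- constraints I]].

Definition enc_solution q n (x : n.-tuple 'I_q) : data F :=
  enc_seq [seq enc_nat i | i : 'I_q <- x].

End Encoding.

(** * Differential approximability *)

(* [iota] embeds the numbers [F] handled by the machine into the field [R] of
   the approximation factor.  The running time is bounded by the polynomial
   [a * X^a + a] in the size of the encoded instance. *)
Definition approximable (F R : realFieldType) (iota : F -> R) (sz : F -> nat)
    (k q : nat) (rho : R) : Prop :=
  exists (prog : cmd) (a : nat), forall I : csp F k q,
    exists (s : store F) (t : nat) (x : (nvars I).-tuple 'I_q),
      [/\ exec sz prog (input_store (enc_csp I)) s t,
          (t <= a * data_size sz (enc_csp I) ^ a + a)%N,
          s 0%N = enc_solution F x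
        & opt I != wor I -> rho <= iota (diff_ratio x)].

Definition bit_length (n : nat) : nat := (trunc_log 2 n).+1.

Definition rat_bit_size (c : rat) : nat :=
  (bit_length `|numq c|%N + bit_length `|denq c|%N)%N.

(* Rational data, time measured in bit operations *)
Definition approximable_rat (R : realFieldType) (k q : nat) (rho : R) : Prop :=
  approximable (F := rat) ratr rat_bit_size k q rho.

(* Arbitrary data in [R], arithmetic operations at unit cost *)
Definition approximable_real (R : realFieldType) (k q : nat) (rho : R) : Prop :=
  approximable (F := R) id (fun=> 1%N) k q rho.

Definition gamma (R : realFieldType) (k p q : nat) : R :=
  2 / ((\sum_(0 <= r < k.+1)
          'C(q - p + k, r) * 'C(q - p + k - 1 - r, k - r))%N%:R + 1).

(* Main.v *)
Require Import Defs.
From mathcomp Require Import all_boot all_order all_algebra.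
From mathcomp Require Import reals.
From mathcomp Require Import zify ring lra.
From Stdlib Require Import FunctionalExtensionality.

Set Implicit Arguments.
Unset Strict Implicit.
Unset Printing Implicit Defensive.

Import Order.TTheory GRing.Theory Num.Theory.
Local Open Scope ring_scope.

(** Composing a solution with a map [u] of the alphabet to itself changes its
    value in a way that depends, constraint by constraint, on the values of [u]
    at no more than [k] symbols.  Call such functionals of [u] local.  Suppose
    that against all local functionals the identity plus the maps of a list
    [Neg] weigh as much as the maps of a list [Pos], and that the maps of [Pos]
    send any solution to one with at most [p] symbols.  Then, for an optimal
    solution [y] of a maximization instance, the sum of the values of [u o y]
    over [Pos] is [opt] plus the sum over [Neg]; it is at most [size Pos] times
    the best value with [p] symbols and at least [opt + size Neg * wor].  As both
    sides have as many terms ([size Pos = size Neg + 1]), the best solution with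
    [p] symbols has differential ratio at least [1 / size Pos].

    The lists are built by induction ([reducing_exists]).  Write [d] for
    [q - p + k]: maps taking at most [k] values on the first [d] symbols are
    wanted, since they take at most [p - k] more on the others.  To add a symbol [j], send
    it to the symbol 0 and reduce the others with the lists for [(d, k)]; what
    this changes, namely the difference between keeping [j] and sending it to 0,
    vanishes unless [j] is read, in which case only [k - 1] other symbols are,
    so the lists for [(d, k - 1)] express it ([balanced_rec]).  The total number
    of maps thus satisfies [S(d+1, k+1) = S(d, k+1) + 2 S(d, k)], the recursion of
    the sum in the definition of [gamma] ([nb_signed_rec]), and
    [size Pos = (S + 1) / 2] gives the factor.  The same recursion, compared with
    the odd terms of the binomial expansion of [(m + 1)^k - (m - 1)^k], yields the
    closed lower bound on [gamma] ([nb_signed_le]).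

    For the approximation result, a map [f] from [p] to [q] symbols turns an
    instance [I] over [q] symbols into the instance over [p] symbols of which the
    solution [y] has the value of [f o y] on [I].  Every solution with at most
    [p] symbols has the form [f o z], and there are only [q ^ p] maps [f]: solving
    all these restrictions within [rho] and keeping the best lifted solution is
    within [gamma * rho] ([restricted_ratio]).  Since the worst value of a
    restriction only lies on the good side of [wor I], this step needs
    [rho <= 1], which a one-variable instance provides ([approximable_le1]).

    What remains is to write this algorithm as a program and to bound its time:
    [runs_value] evaluates a solution, [solver_best] keeps the better of the
    outputs of two programs, and [solver_restrict] builds a restriction, calls a
    program on it and lifts the result.  The only properties of the cost of
    numbers that matter are gathered in [tame]: they hold both at unit cost and
    for bit lengths of rationals. *)

(** * The number of maps in a reduction *)

Definition nb_signed (d k : nat) : nat :=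
  (\sum_(0 <= r < k.+1) 'C(d, r) * 'C(d - 1 - r, k - r))%N.

Lemma nb_signed0 d : nb_signed d 0 = 1%N.
Proof. by rewrite /nb_signed big_nat1 !bin0. Qed.

Lemma nb_signed_diag k : nb_signed k k = 1%N.
Proof.
rewrite /nb_signed big_nat_recr //= binn subnn bin0 muln1.
rewrite big_nat big1 // => r /andP[_ rk].
by rewrite [X in (_ * X)%N]bin_small ?muln0 //; lia.
Qed.

(** Pascal's rule on both binomial coefficients; each of them contributes one
    copy of the sum for [(d, k)]. *)
Lemma nb_signed_rec d k : (k < d)%N ->
  nb_signed d.+1 k.+1 = (nb_signed d k.+1 + 2 * nb_signed d k)%N.
Proof.
move=> kd; rewrite /nb_signed.
have binS1 r : (r < k.+1)%N ->
    'C(d.+1 - 1 - r, k.+1 - r) = ('C(d - 1 - r, k.+1 - r) + 'C(d - 1 - r, k - r))%N.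
  move=> rk; rewrite (_ : (d.+1 - 1 - r = (d - 1 - r).+1)%N); last by lia.
  by rewrite (_ : (k.+1 - r = (k - r).+1)%N) ?binS //; lia.
have split1 : (\sum_(0 <= r < k.+2) 'C(d, r) * 'C(d.+1 - 1 - r, k.+1 - r) =
    \sum_(0 <= r < k.+2) 'C(d, r) * 'C(d - 1 - r, k.+1 - r) +
    \sum_(0 <= r < k.+1) 'C(d, r) * 'C(d - 1 - r, k - r))%N.
  rewrite big_nat_recr // [in RHS]big_nat_recr //= !subnn !bin0 !muln1.
  rewrite addnAC -big_split /=; congr addn.
  by apply: eq_big_nat => r /andP[_ rk]; rewrite binS1 // mulnDr.
have split2 : (\sum_(0 <= r < k.+2) 'C(d.+1, r) * 'C(d.+1 - 1 - r, k.+1 - r) =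
    \sum_(0 <= r < k.+2) 'C(d, r) * 'C(d.+1 - 1 - r, k.+1 - r) +
    \sum_(0 <= r < k.+1) 'C(d, r) * 'C(d - 1 - r, k - r))%N.
  rewrite big_nat_recl // [in RHS]big_nat_recl //= !bin0 -addnA; congr addn.
  rewrite -big_split /=; apply: eq_big_nat => r /andP[_ rk].
  rewrite binS mulnDl; congr (_ + _ * 'C(_, _))%N; lia.
by rewrite split2 split1; lia.
Qed.

Lemma bernoulli_expn m k : (m.+1 ^ k.+1 <= m ^ k.+1 + k.+1 * m.+1 ^ k)%N.
Proof.
elim: k => [|k IHk]; first by rewrite !expn1 expn0; lia.
rewrite [leqLHS]expnS (expnS m); move: IHk; rewrite [(m.+1 ^ k.+1)%N]expnS.
by move: (m ^ k.+1)%N (m.+1 ^ k)%N => x y; nia.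
Qed.

(** Centered at [m + 1], the binomial expansions of the two extreme powers differ
    by twice their odd terms, of which the first is kept. *)
Lemma expn_odd_terms m k :
  (m ^ k.+1 + 2 * k.+1 * m.+1 ^ k <= m.+2 ^ k.+1)%N.
Proof.
elim: k => [|k IHk]; first by rewrite !expn1 expn0; lia.
have := bernoulli_expn m k.
rewrite (expnS m.+2 k.+1) (expnS m k.+1) (expnS m.+1 k).
move: IHk; move: (m ^ k.+1)%N (m.+1 ^ k)%N (m.+2 ^ k.+1)%N => x y z; nia.
Qed.

(** The bound of [nb_signed_le] is an equality for [k = 2] and fails for [k = 1],
    so that this case is the base of the induction on [k]. *)
Lemma nb_signed2 d : (2 <= d)%N -> (nb_signed d 2 + 1 = 2 * (d - 1) ^ 2)%N.
Proof.
have nb1 e : (1 <= e)%N -> nb_signed e 1 = (2 * e - 1)%N.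
  elim: e => // -[_ _|e IHe _]; first by rewrite nb_signed_diag.
  by rewrite nb_signed_rec // IHe // nb_signed0; lia.
elim: d => // -[//|[_ _|d IHd _]]; first by rewrite nb_signed_diag.
by rewrite nb_signed_rec // nb1 //; have := IHd isT; rewrite !expnS !expn0; nia.
Qed.

(** Passing from [(d, k + 1)] and [(d, k)] to [(d + 1, k + 1)], the recursion adds
    [m ^ (k + 1)] and [2 * (k + 1) * (m + 1) ^ k] for [m = 2 * d - k - 1], which
    [expn_odd_terms] bounds by [(m + 2) ^ (k + 1)]. *)
Lemma nb_signed_le d k : (2 <= k <= d)%N ->
  ((nb_signed d k + 1) * k`! <= (2 * d - k) ^ k)%N.
Proof.
have fact_le j : (2 <= j)%N -> (2 * j`! <= j ^ j)%N.
  elim: j => // -[//|[//|j IHj _]].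
  rewrite factS mulnCA expnS leq_mul2l /=.
  by apply: leq_trans (IHj isT) _; rewrite leq_exp2r.
elim: d k => [|d IHd] k kd; first by lia.
have [->|k_neq_d] := eqVneq k d.+1.
  rewrite nb_signed_diag; have -> : (2 * d.+1 - d.+1 = d.+1)%N by lia.
  by apply: fact_le; lia.
have {kd k_neq_d} [k2 kd] : (2 <= k /\ k <= d)%N by lia.
have [->|kn2] := eqVneq k 2.
  rewrite nb_signed2; last by lia.
  by rewrite (_ : 2`! = 2) // !expnS !expn0; nia.
case: k k2 kd kn2 => [//|k] k2 kd kn2.
have k_ge2 : (2 <= k)%N by lia.
rewrite nb_signed_rec //.
have := IHd k.+1 ltac:(lia); have := IHd k ltac:(lia).
set m := (2 * d - k.+1)%N.
have -> : (2 * d - k = m.+1)%N by lia.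
have -> : (2 * d.+1 - k.+1 = m.+2)%N by lia.
have := expn_odd_terms m k.
rewrite factS.
move: (m ^ k.+1)%N (m.+1 ^ k)%N (m.+2 ^ k.+1)%N k`! => x y z f.
by move: (nb_signed d k) (nb_signed d k.+1) => a b; nia.
Qed.

(** * Signed families of alphabet maps *)

Lemma cardsU1_le (T : finType) (a : T) (A : {set T}) m :
  (#|A| <= m)%N -> (#|a |: A| <= m.+1)%N.
Proof. by rewrite cardsU1; case: (a \notin A) => // /leqW. Qed.

Section AlphabetReduction.
Variable n : nat.
Local Notation fun_n := {ffun 'I_n.+1 -> 'I_n.+1}.
Implicit Types (u w : fun_n) (d k : nat).

Definition local (V : Type) k (g : fun_n -> V) : Prop :=
  exists2 J : seq 'I_n.+1, (size J <= k)%N &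
    forall u w, {in J, u =1 w} -> g u = g w.

(** In the language of arrays, the rows [Pos] and the rows [Neg] together with
    the row of all symbols have the same [k]-dimensional marginals. *)
Definition balanced k (Pos Neg : seq fun_n) : Prop :=
  forall (V : zmodType) (g : fun_n -> V), local k g ->
    g (finfun id) + \sum_(u <- Neg) g u = \sum_(u <- Pos) g u.

Definition low d : {set 'I_n.+1} := [set j : 'I_n.+1 | (j < d)%N].

Definition redirect (u : fun_n) (j a : 'I_n.+1) : fun_n :=
  [ffun i => if i == j then a else u i].

Definition identify (j a : 'I_n.+1) (u : fun_n) : fun_n :=
  [ffun i => if i == j then u a else u i].

Lemma card_low d : (d <= n.+1)%N -> #|low d| = d.
Proof.
move=> dn; have -> : low d = widen_ord dn @: [set: 'I_d].
  apply/setP => i; rewrite inE; apply/idP/imsetP => [id|[j _ ->]]; last exact: (ltn_ord j).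
  by exists (Ordinal id) => //; apply: val_inj.
by rewrite card_imset ?cardsT ?card_ord // => i j /(congr1 val) /= /val_inj.
Qed.

Lemma low_rec (j : 'I_n.+1) : low j.+1 = j |: low j.
Proof. by apply/setP => i; rewrite !inE ltnS leq_eqVlt val_eqE. Qed.

Lemma redirect_imset u (j a : 'I_n.+1) :
  redirect u j a @: low j.+1 \subset a |: u @: low j.
Proof.
apply/subsetP => _ /imsetP[i ilow ->]; rewrite ffunE.
case: eqVneq => [_|ineqj]; first by rewrite setU11.
apply/setU1P; right; apply: imset_f.
by move: ilow; rewrite low_rec !inE (negbTE ineqj).
Qed.

Lemma identify_imset u (j a : 'I_n.+1) : (a < j)%N ->
  identify j a u @: low j.+1 \subset u @: low j.
Proof.
move=> aj; apply/subsetP => _ /imsetP[i ilow ->]; rewrite ffunE.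
have [_|ineqj] := eqVneq i j; apply: imset_f; first by rewrite inE.
by move: ilow; rewrite low_rec !inE (negbTE ineqj).
Qed.

(** The identity is the sum of the map that sends [j] to [a] and of the difference
    between keeping and redirecting [j].  Against a functional [g] reading [J], the
    first is reduced by [Pos] and [Neg]; the second is 0 if [j] is not in [J], and
    otherwise a functional reading [J] without [j], reduced by [Wpos] and
    [Wneg]. *)
Lemma balanced_rec (j a : 'I_n.+1) k Pos Neg Wpos Wneg :
    balanced k.+1 Pos Neg -> balanced k Wpos Wneg ->
  balanced k.+1
    (map (identify j a) Pos ++ [seq redirect w j j | w <- Wpos]
       ++ [seq redirect w j a | w <- Wneg])
    (map (identify j a) Neg ++ [seq redirect w j j | w <- Wneg]
       ++ [seq redirect w j a | w <- Wpos]).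
Proof.
move=> balP balW V g [J sizeJ locg].
have redirect_id : redirect (finfun id) j j = finfun id.
  by apply/ffunP => i; rewrite !ffunE; case: eqP.
have identify_id : identify j a (finfun id) = redirect (finfun id) j a.
  by apply/ffunP => i; rewrite !ffunE.
have eqI : g (redirect (finfun id) j a) + \sum_(u <- Neg) g (identify j a u) =
    \sum_(u <- Pos) g (identify j a u).
  rewrite -identify_id; apply: (balP V (fun u => g (identify j a u))).
  exists [seq (if i == j then a else i) | i <- J].
    by rewrite size_map.
  move=> u w uw; apply: locg => i iJ; rewrite !ffunE.
  by have := uw _ (map_f _ iJ); case: eqP.
have eqR : g (redirect (finfun id) j j) - g (redirect (finfun id) j a) +
    \sum_(w <- Wneg) (g (redirect w j j) - g (redirect w j a)) =
    \sum_(w <- Wpos) (g (redirect w j j) - g (redirect w j a)).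
  apply: (balW V (fun w => g (redirect w j j) - g (redirect w j a))).
  have [jJ|jNJ] := boolP (j \in J); last first.
    exists [::] => // u w _; rewrite (locg (redirect u j j) (redirect u j a)).
      rewrite (locg (redirect w j j) (redirect w j a)) ?subrr // => i iJ.
      by rewrite !ffunE; case: eqP => // ij; rewrite -ij iJ in jNJ.
    move=> i iJ.
    by rewrite !ffunE; case: eqP => // ij; rewrite -ij iJ in jNJ.
  exists (filter (predC (pred1 j)) J).
    have := count_predC (pred1 j) J; rewrite size_filter.
    move: jJ sizeJ; rewrite -has_pred1 has_count => + + sumJ.
    by rewrite -sumJ; move: (count_mem j J) (count _ J) => c b; lia.
  move=> u w uw; congr (_ - _); apply: locg => i iJ; rewrite !ffunE;
    by case: eqVneq => // ij; apply: uw; rewrite mem_filter /= ij.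
rewrite !big_cat /= !big_map -eqI; move/eqP: eqR; rewrite !sumrB redirect_id.
rewrite addrACA -opprD subr_eq addrAC eq_sym subr_eq => /eqP eqR.
by rewrite [LHS]addrCA [X in _ + X = _]addrA -eqR [X in _ + X = _]addrCA [LHS]addrCA addrA.
Qed.

(** The last condition only serves the induction: redirecting a map of [Neg] to
    the symbol 0 produces a map of [Pos] for the next level, whose image must not
    be too large. *)
Definition reducing d k (Pos Neg : seq fun_n) : Prop :=
  [/\ balanced k Pos Neg,
      size Pos = (size Neg).+1 /\ (size Pos + size Neg)%N = nb_signed d k,
      {in Pos, forall u, #|u @: low d| <= k}%N
    & {in Neg, forall u, #|ord0 |: u @: low d| <= k.+1}%N].

(** At level 0 any single map is equivalent to the identity; choosing the map
    constantly equal to the new symbol [j] makes the maps added at level 1 take a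
    single value where this is required. *)
Lemma reducing_exists d k : (1 <= k <= d)%N -> (d <= n.+1)%N ->
  exists Pos Neg, reducing d k Pos Neg.
Proof.
elim: d k => [|d IHd] k kd dn; first by lia.
have [kd1|kd1] := eqVneq k d.+1.
  exists [:: finfun id], [::]; split => //=.
  - by move=> V g _; rewrite big_nil big_seq1 addr0.
  - by rewrite kd1 nb_signed_diag.
  by move=> u _; apply: leq_trans (leq_imset_card _ _) _; rewrite card_low ?kd1.
case: k kd kd1 => // k kd kd1.
have [Pos [Neg [balP [szP sumP] imP imN]]] := IHd k.+1 ltac:(lia) ltac:(lia).
pose j := Ordinal dn; have j_gt0 : ((ord0 : 'I_n.+1) < j)%N by rewrite /=; lia.
suff [Wpos [Wneg [[balW szW sumW] [imWp imWn] imW0]]] : exists Wpos Wneg : seq fun_n,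
    [/\ [/\ balanced k Wpos Wneg, size Wpos = (size Wneg).+1
          & (size Wpos + size Wneg)%N = nb_signed d k],
        {in Wpos, forall w, #|j |: w @: low d| <= k.+1}%N /\
        {in Wneg, forall w, #|ord0 |: w @: low d| <= k.+1}%N
      & {in Wpos, forall w, #|ord0 |: w @: low d| <= k.+2}%N].
  exists (map (identify j ord0) Pos ++ [seq redirect w j j | w <- Wpos]
       ++ [seq redirect w j ord0 | w <- Wneg]).
  exists (map (identify j ord0) Neg ++ [seq redirect w j j | w <- Wneg]
       ++ [seq redirect w j ord0 | w <- Wpos]).
  split; first exact: balanced_rec.
  - rewrite nb_signed_rec; last by lia.
    by rewrite -sumW -sumP !size_cat !size_map szP szW; lia.
  - move=> u; rewrite !mem_cat => /or3P[] /mapP[w wP ->].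
    + exact: leq_trans (subset_leq_card (identify_imset _ j_gt0)) (imP w wP).
    + exact: leq_trans (subset_leq_card (redirect_imset _ j j)) (imWp w wP).
    + exact: leq_trans (subset_leq_card (redirect_imset _ j ord0)) (imWn w wP).
  - move=> u; rewrite !mem_cat => /or3P[] /mapP[w wP ->].
    + apply: leq_trans (imN w wP).
      by apply/subset_leq_card/setUS; exact: identify_imset.
    + apply: (@leq_trans #|j |: (ord0 |: w @: low d)|).
        by apply: subset_leq_card; rewrite setUCA; apply/setUS/redirect_imset.
      by apply/cardsU1_le/imWn.
    + apply: leq_trans (imW0 w wP); apply: subset_leq_card.
      by rewrite subUset sub1set setU11 redirect_imset.
case: k kd kd1 {Pos Neg balP szP sumP imP imN} => [|k] kd kd1.
  (* A 0-local functional is constant. *)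
  exists [:: [ffun=> j]], [::]; split=> //=.
    split=> //; last by rewrite nb_signed0.
    move=> V g [[|//] _ locg]; rewrite big_nil big_seq1 addr0.
    exact: locg.
  split=> // w; rewrite inE => /eqP->.
    apply: (@leq_trans #|[set j]|); last by rewrite cards1.
    apply: subset_leq_card; rewrite subUset subxx /=.
    by apply/subsetP => _ /imsetP[i _ ->]; rewrite ffunE inE.
  move=> w; rewrite inE => /eqP->.
  apply: (@leq_trans #|[set ord0; j]|); last by rewrite cards2; case: (_ != _).
  apply: subset_leq_card; rewrite subUset sub1set !inE eqxx /=.
  by apply/subsetP => _ /imsetP[i _ ->]; rewrite ffunE !inE eqxx orbT.
have [Wpos [Wneg [balW [szW sumW] imWp imWn]]] := IHd k.+1 ltac:(lia) ltac:(lia).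
have card_add (a : 'I_n.+1) w m : (#|w @: low d| <= m)%N -> (#|a |: w @: low d| <= m.+1)%N.
  by apply: cardsU1_le.
exists Wpos, Wneg; split=> //; first by split=> // w /imWp; exact: card_add.
by move=> w /imWp le_im; apply/leqW/card_add.
Qed.

End AlphabetReduction.

(** * The differential ratio of solutions with few symbols *)

Section Ratio.
Variables (F : realFieldType) (k n : nat) (I : csp F k n.+1).
Implicit Types (x y : (nvars I).-tuple 'I_n.+1).
Local Notation value := (@value F k n.+1 I).

(** Multiplying values by this sign reduces minimization to maximization. *)
Definition goal_sign : F := if maximizing I then 1 else - 1.

Lemma goal_signK (v : F) : goal_sign * (goal_sign * v) = v.
Proof. by rewrite /goal_sign; case: maximizing; rewrite ?mul1r ?mulN1r ?opprK. Qed.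

Lemma at_least_as_goodE x y :
  at_least_as_good x y = (goal_sign * value y <= goal_sign * value x).
Proof.
by rewrite /at_least_as_good /goal_sign; case: maximizing;
  rewrite ?mul1r ?mulN1r ?lerN2.
Qed.

Lemma mem_values x : value x \in values I.
Proof. by apply/imageP; exists x. Qed.

Lemma values_neq0 : values I != [::].
Proof. by have := mem_values [tuple ord0 | _ < nvars I]; case: (values I). Qed.

Lemma max_valueP : exists2 x, max_value I = value x & forall y, value y <= value x.
Proof.
have [x x_max] : exists x, forall y, value y <= value x.
  exists [arg max_(x > [tuple ord0 | _ < nvars I] | true) value x]%O.
  by case: arg_maxP => // x _ x_max y; exact: x_max.
exists x => //; apply/eqP; rewrite eq_le /max_value.
apply/andP; split; last by apply: bigmax_sup_seq (mem_values x) _ _.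
rewrite big_seq; apply: bigmax_le => [|v vin]; last first.
  by have /imageP[y _ ->] := vin; exact: x_max.
have := values_neq0; case E : (values I) => [//|v s] _ /=.
have : v \in values I by rewrite E mem_head.
by move=> /imageP[y _ ->]; exact: x_max.
Qed.

Lemma min_valueP : exists2 x, min_value I = value x & forall y, value x <= value y.
Proof.
have [x x_min] : exists x, forall y, value x <= value y.
  exists [arg min_(x < [tuple ord0 | _ < nvars I] | true) value x]%O.
  by case: arg_minP => // x _ x_min y; exact: x_min.
exists x => //; apply/eqP; rewrite eq_le /min_value.
apply/andP; split; first by apply: bigmin_inf_seq (mem_values x) _ _.
rewrite big_seq; apply: le_bigmin => [|v vin]; last first.
  by have /imageP[y _ ->] := vin; exact: x_min.
have := values_neq0; case E : (values I) => [//|v s] _ /=.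
have : v \in values I by rewrite E mem_head.
by move=> /imageP[y _ ->]; exact: x_min.
Qed.

Lemma optP : exists2 x, opt I = value x & forall y, at_least_as_good x y.
Proof.
rewrite /opt /at_least_as_good.
by case: maximizing; [exact: max_valueP | exact: min_valueP].
Qed.

Lemma worP : exists2 x, wor I = value x & forall y, at_least_as_good y x.
Proof.
rewrite /wor /at_least_as_good.
by case: maximizing; [exact: min_valueP | exact: max_valueP].
Qed.

Lemma goal_sign_opt x : goal_sign * value x <= goal_sign * opt I.
Proof. by have [y -> y_opt] := optP; rewrite -at_least_as_goodE. Qed.

Lemma goal_sign_wor x : goal_sign * wor I <= goal_sign * value x.
Proof. by have [y -> y_opt] := worP; rewrite -at_least_as_goodE. Qed.

Lemma diff_ratioE x : diff_ratio x =
  (goal_sign * value x - goal_sign * wor I) / (goal_sign * opt I - goal_sign * wor I).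
Proof.
rewrite /diff_ratio -!mulrBr /goal_sign; case: maximizing; first by rewrite !mul1r.
by rewrite !mulN1r invrN mulrNN.
Qed.

Lemma opt_gt_wor : opt I != wor I -> goal_sign * wor I < goal_sign * opt I.
Proof.
move=> opt_wor; have [x worE _] := worP.
rewrite lt_neqAle [in X in _ && X]worE goal_sign_opt andbT.
apply: contra opt_wor => /eqP E.
by rewrite -[opt I]goal_signK -E goal_signK.
Qed.

End Ratio.

Section Restriction.
Variables (F : realFieldType) (k n : nat).
Implicit Types (I : csp F k n.+1).

Lemma balanced_value I Pos Neg (x : (nvars I).-tuple 'I_n.+1) :
  balanced k Pos Neg ->
  value x + \sum_(u <- Neg) value (map_tuple u x) =
    \sum_(u <- Pos) value (map_tuple u x).
Proof.
move=> bal; rewrite /value exchange_big [RHS]exchange_big -big_split /=.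
apply: eq_bigr => c _.
have := bal F (fun u => weight c *
  func c (map_tuple (tnth (map_tuple u x)) (scope c))).
have -> : map_tuple (finfun id) x = x.
  by apply: eq_from_tnth => i; rewrite tnth_map ffunE.
apply; exists [seq tnth x i | i <- scope c].
  by rewrite size_map size_tuple; have := arity_bounds c; lia.
move=> u w uw; congr (_ * func c _); apply: eq_from_tnth => i.
by rewrite !tnth_map; apply/uw/map_f/mem_tnth.
Qed.

(** A map with [m] values on the first [d] symbols has at most [n.+1 - d] further
    values on the others. *)
Lemma nb_distinct_map I (u : {ffun 'I_n.+1 -> 'I_n.+1}) d m p
    (x : (nvars I).-tuple 'I_n.+1) :
  (#|u @: low n d| <= m)%N -> (d <= n.+1)%N -> (m + (n.+1 - d) <= p)%N ->
  (nb_distinct (map_tuple u x) <= p)%N.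
Proof.
move=> im_low dn m_p; apply: leq_trans m_p.
apply: (@leq_trans #|u @: low n d :|: u @: ~: low n d|).
  rewrite /nb_distinct cardE; apply: uniq_leq_size; first exact: undup_uniq.
  move=> v; rewrite mem_undup mem_enum => /mapP[i _ ->].
  rewrite inE; case: (boolP (i \in low n d)) => il; first by rewrite imset_f.
  by rewrite orbC imset_f // inE.
apply: leq_trans (leq_card_setU _ _) _; apply: leq_add => //.
apply: leq_trans (leq_imset_card _ _) _.
by rewrite cardsCs setCK card_ord card_low.
Qed.

(** The bound on the differential ratio with the denominators cleared, which makes
    it easy to transport along an embedding of fields. *)
Lemma ratio_few_symbols I p (x : (nvars I).-tuple 'I_n.+1) :
    (1 <= k <= p)%N -> (p <= n.+1)%N -> best_with_at_most p x ->
  2 * (goal_sign I * opt I - goal_sign I * wor I) <=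
    (nb_signed (n.+1 - p + k) k + 1)%:R * (goal_sign I * value x - goal_sign I * wor I).
Proof.
move=> kp pn [_ x_best]; set d := (n.+1 - p + k)%N.
have [Pos [Neg [bal [szP sumP] imP _]]] := @reducing_exists n d k ltac:(lia) ltac:(lia).
have [y -> _] := optP I.
set s := goal_sign I; set b := s * value x; set w := s * wor I.
have sum_const (r : seq {ffun 'I_n.+1 -> 'I_n.+1}) (z : F) :
    \sum_(u <- r) z = (size r)%:R * z.
  by rewrite big_const_seq count_predT iter_addr_0 mulr_natl.
have le_Pos : \sum_(u <- Pos) s * value (map_tuple u y) <= (size Pos)%:R * b.
  rewrite -sum_const big_seq [leRHS]big_seq; apply: ler_sum => u uP.
  rewrite -at_least_as_goodE; apply: x_best.
  by apply: (nb_distinct_map _ (imP u uP)); lia.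
have le_Neg : (size Neg)%:R * w <= \sum_(u <- Neg) s * value (map_tuple u y).
  by rewrite -sum_const; apply: ler_sum => u _; exact: goal_sign_wor.
have := congr1 ( *%R s) (balanced_value y bal); rewrite mulrDr !mulr_sumr.
have -> : (nb_signed d k + 1)%:R = 2 * (size Pos)%:R :> F.
  by rewrite -natrM; congr (_%:R); lia.
move: le_Pos le_Neg; rewrite szP -natr1; lra.
Qed.

End Restriction.

(** * Stores, renaming of variables and bounded execution *)

Local Notation leaf := Defs.Nil.

Section Stores.
Variable F : realFieldType.

(** A store is an infinite stream of registers; writing its first registers
    explicitly lets assignments be computed by simplification. *)
Definition scons (d : data F) (s : store F) : store F :=
  fun x => if x is y.+1 then s y else d.

Arguments scons d s !x /.

Definition empty_store : store F := fun=> leaf.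

(** Two programs run in the same store without interfering once the variables of
    one are doubled and those of the other become odd. *)
Definition interleave (s1 s2 : store F) : store F :=
  fun x => if odd x then s2 x./2 else s1 x./2.

Lemma update_scons0 d s e : update (scons d s) 0 e = scons e s.
Proof. by apply: functional_extensionality => -[]. Qed.

Lemma update_sconsS d s x e : update (scons d s) x.+1 e = scons d (update s x e).
Proof. by apply: functional_extensionality => -[|y] //=; rewrite /update eqSS. Qed.

Lemma update_same (s : store F) x e : e = s x -> update s x e = s.
Proof.
by move=> ->; apply: functional_extensionality => y; rewrite /update; case: eqP => // ->.
Qed.

Lemma empty_storeE : empty_store = scons leaf empty_store.
Proof. by apply: functional_extensionality => -[]. Qed.

Lemma input_storeE d : input_store d = scons d empty_store.
Proof. by rewrite /input_store -/empty_store {1}empty_storeE update_scons0. Qed.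

Lemma interleave_empty : interleave empty_store empty_store = empty_store.
Proof. by apply: functional_extensionality => x; rewrite /interleave; case: odd. Qed.

Lemma interleave_scons d1 d2 s1 s2 :
  interleave (scons d1 s1) (scons d2 s2) = scons d1 (scons d2 (interleave s1 s2)).
Proof.
apply: functional_extensionality => -[|[|x]] //.
by rewrite /interleave /= negbK.
Qed.

Fixpoint rename_expr (f : nat -> nat) (e : expr) : expr :=
  match e with
  | EVar x => EVar (f x)
  | ENil => ENil
  | EConst z => EConst z
  | ECons e1 e2 => ECons (rename_expr f e1) (rename_expr f e2)
  | EHd e => EHd (rename_expr f e)
  | ETl e => ETl (rename_expr f e)
  | EIsNum e => EIsNum (rename_expr f e)
  | EAdd e1 e2 => EAdd (rename_expr f e1) (rename_expr f e2)
  | ESub e1 e2 => ESub (rename_expr f e1) (rename_expr f e2)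
  | EMul e1 e2 => EMul (rename_expr f e1) (rename_expr f e2)
  | EDiv e1 e2 => EDiv (rename_expr f e1) (rename_expr f e2)
  | ELe e1 e2 => ELe (rename_expr f e1) (rename_expr f e2)
  end.

Fixpoint rename (f : nat -> nat) (c : cmd) : cmd :=
  match c with
  | CSkip => CSkip
  | CAssign x e => CAssign (f x) (rename_expr f e)
  | CSeq c1 c2 => CSeq (rename f c1) (rename f c2)
  | CIf e c1 c2 => CIf (rename_expr f e) (rename f c1) (rename f c2)
  | CWhile e c => CWhile (rename_expr f e) (rename f c)
  end.

Variable sz : F -> nat.

(** The store [E s] holds [s] in the variables renamed by [f]; as [E] commutes with
    updates, a renamed program acts on that part only. *)
Definition embedding (f : nat -> nat) (E : store F -> store F) : Prop :=
  (forall s x, E s (f x) = s x) /\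
  (forall s x d, E (update s x d) = update (E s) (f x) d).

Lemma eval_rename f E e s : embedding f E -> eval (rename_expr f e) (E s) = eval e s.
Proof.
move=> [Ef _]; elim: e => //= [e1 -> e2 ->|e ->|e ->|e ->|e1 -> e2 ->|e1 -> e2 ->
  |e1 -> e2 ->|e1 -> e2 ->|e1 -> e2 ->] //.
Qed.

Lemma eval_cost_rename f E e s : embedding f E ->
  eval_cost sz (rename_expr f e) (E s) = eval_cost sz e s.
Proof.
move=> Ef; elim: e => //= [e1 -> e2 ->|e ->|e ->|e ->|e1 -> e2 ->|e1 -> e2 ->
  |e1 -> e2 ->|e1 -> e2 ->|e1 -> e2 ->] //; by rewrite !(eval_rename _ _ Ef).
Qed.

Lemma exec_rename f E c s s' t : embedding f E ->
  exec sz c s s' t -> exec sz (rename f c) (E s) (E s') t.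
Proof.
move=> Ef; have ev := fun e s => eval_rename e s Ef.
have co := fun e s => eval_cost_rename e s Ef.
elim=> {c s s' t} /=.
- by move=> s; constructor.
- by move=> x e s; rewrite -ev -co (proj2 Ef); constructor.
- by move=> c1 c2 s1 s2 s3 t1 t2 _ H1 _ H2; econstructor; eassumption.
- by move=> e c1 c2 s s' t te _ H; rewrite -co; constructor => //; rewrite ev.
- by move=> e c1 c2 s s' t te _ H; rewrite -co; apply: exec_if_false => //; rewrite ev.
- by move=> e c s1 s2 s3 t1 t2 te _ H1 _ H2; rewrite -co;
    apply: exec_while_true H1 H2; rewrite ev.
- by move=> e c s te; rewrite -co; apply: exec_while_false; rewrite ev.
Qed.

Lemma embedding_scons d : embedding S (scons d).
Proof. by split=> // s x e; rewrite update_sconsS. Qed.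

Lemma embedding_left s2 : embedding double (interleave^~ s2).
Proof.
split=> [s x|s x d]; first by rewrite /interleave odd_double doubleK.
apply: functional_extensionality => y; rewrite /interleave /update.
have [oy|ey] := boolP (odd y).
  by case: eqP => // yE; rewrite yE odd_double in oy.
have -> : (y == x.*2) = (y./2 == x).
  by rewrite -[in LHS](even_halfK ey) (inj_eq double_inj).
by [].
Qed.

Lemma embedding_right s1 : embedding (fun x => x.*2.+1) (interleave s1).
Proof.
split=> [s x|s x d]; first by rewrite /interleave /= odd_double /= uphalf_double.
apply: functional_extensionality => y; rewrite /interleave /update.
have [oy|ey] := boolP (odd y); last first.
  by case: eqP => // yE; rewrite yE /= odd_double in ey.
have -> : (y == x.*2.+1) = (y./2 == x).
  by rewrite -[in LHS](odd_double_half y) oy add1n eqSS (inj_eq double_inj).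
by [].
Qed.

Definition runs c s s' b : Prop := exists2 t, exec sz c s s' t & (t <= b)%N.

Lemma runs_leq b c s s' b' : runs c s s' b -> (b <= b')%N -> runs c s s' b'.
Proof. by move=> [t ct tb] bb; exists t => //; exact: leq_trans bb. Qed.

Lemma runs_assign x e s : runs (CAssign x e) s (update s x (eval e s)) (1 + eval_cost sz e s).
Proof. by exists (1 + eval_cost sz e s)%N => //; constructor. Qed.

Lemma runs_seq c1 c2 s1 s2 s3 b1 b2 :
  runs c1 s1 s2 b1 -> runs c2 s2 s3 b2 -> runs (CSeq c1 c2) s1 s3 (b1 + b2).
Proof.
move=> [t1 e1 l1] [t2 e2 l2]; exists (t1 + t2)%N; last exact: leq_add.
exact: exec_seq e1 e2.
Qed.

Lemma runs_if (e : expr) c1 c2 s s' b :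
  runs (if truth (eval e s) then c1 else c2) s s' b ->
  runs (CIf e c1 c2) s s' (1 + eval_cost sz e s + b).
Proof.
case: ifP => te [t et lt]; (exists (1 + eval_cost sz e s + t)%N; last by rewrite leq_add2l).
  exact: exec_if_true.
by apply: exec_if_false => //; rewrite te.
Qed.

Lemma runs_while_end e c s b : ~~ truth (eval e s) -> (1 + eval_cost sz e s <= b)%N ->
  runs (CWhile e c) s s b.
Proof. by move=> te lb; exists (1 + eval_cost sz e s)%N => //; constructor. Qed.

Lemma runs_while_step e c s1 s2 s3 b0 b1 b2 : truth (eval e s1) ->
  (1 + eval_cost sz e s1 <= b0)%N ->
  runs c s1 s2 b1 -> runs (CWhile e c) s2 s3 b2 ->
  runs (CWhile e c) s1 s3 (b0 + b1 + b2).
Proof.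
move=> te lb [t1 e1 l1] [t2 e2 l2]; exists (1 + eval_cost sz e s1 + t1 + t2)%N.
  exact: exec_while_true e1 e2.
by rewrite leq_add // leq_add.
Qed.

(** A loop consuming the list held in the variable [v].  [st t l] is the store when
    [l] remains and [t] has been accumulated; [Inv] carries the bounds on [t]
    needed for the uniform cost [b] of an iteration. *)
Lemma runs_foreach (A T : Type) (Inv : T -> seq A -> Prop) (step : T -> A -> T)
    (st : T -> seq A -> store F) v c b t l :
    (forall t, st t [::] v = leaf) ->
    (forall t a l, Inv t (a :: l) ->
      [/\ Inv (step t a) l, truth (st t (a :: l) v)
        & runs c (st t (a :: l)) (st (step t a) l) b]) ->
    Inv t l ->
  runs (CWhile (EVar v) c) (st t l) (st (foldl step t l) [::]) ((size l).+1 * (2 + b)).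
Proof.
move=> st_nil st_cons; elim: l t => [|a l IHl] t invt /=.
  by apply: runs_while_end => //=; rewrite ?st_nil // mul1n.
have [invl ta ca] := st_cons t a l invt.
by rewrite mulSn; apply: runs_while_step ca (IHl _ invl).
Qed.

Lemma runs_assign_seq x e c s s' b : runs c (update s x (eval e s)) s' b ->
  runs (CSeq (CAssign x e) c) s s' (1 + eval_cost sz e s + b).
Proof. exact: runs_seq (runs_assign _ _ _). Qed.

Lemma runs_assign_eq x e s s' b : s' = update s x (eval e s) ->
  (1 + eval_cost sz e s <= b)%N -> runs (CAssign x e) s s' b.
Proof. by move=> ->; exact: runs_leq (runs_assign _ _ _). Qed.

End Stores.
Arguments scons {F} d s !x /.

Local Infix ":::" := scons (at level 60, right associativity).
Local Notation "x <~ e" := (CAssign x e) (at level 61).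
Local Notation "c1 ;; c2" := (CSeq c1 c2) (at level 62, right associativity).

Definition update_scons := (update_scons0, update_sconsS).

(** Requirements on the cost of numbers.  The last one is on whole sums because a
    bound on the size of [u + v] would be useless when iterated: the bit length of
    a sum of two rationals can be nearly twice the sum of their bit lengths. *)
Definition tame (F : realFieldType) (sz : F -> nat) (c0 : nat) : Prop :=
  [/\ forall m : nat, (sz (m%:R)%R <= m + c0)%N,
      forall u v, (sz (u * v)%R <= sz u + sz v + c0)%N
    & forall s : seq F, (sz (\sum_(u <- s) u)%R <= 2 * (\sum_(u <- s) (sz u).+1) + c0)%N].

(** * Programming idioms *)

(** The cost of expressions without arithmetic does not depend on the store. *)
Fixpoint arith_free (e : expr) : bool :=
  match e with
  | EVar _ | ENil | EConst _ => true
  | EHd e | ETl e | EIsNum e => arith_free e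
  | ECons e1 e2 => arith_free e1 && arith_free e2
  | _ => false
  end.

Fixpoint expr_size (e : expr) : nat :=
  match e with
  | EVar _ | ENil | EConst _ => 1
  | EHd e | ETl e | EIsNum e => 1 + expr_size e
  | ECons e1 e2 | EAdd e1 e2 | ESub e1 e2 | EMul e1 e2 | EDiv e1 e2 | ELe e1 e2 =>
      1 + expr_size e1 + expr_size e2
  end%N.

Definition seq_expr (es : seq expr) : expr := foldr ECons ENil es.

Definition nth_expr (e : expr) (i : nat) : expr := EHd (iter i ETl e).

(** A table indexed by words of length [a], laid out as a [q]-ary tree of depth [a]
    so that it can be looked up symbol by symbol.  The order in which a table is
    listed is a fixed but unspecified enumeration; for a given arity, the whole
    tree is therefore a constant expression in the table. *)
Fixpoint tree_expr q a (g : seq 'I_q -> expr) : expr :=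
  if a is a'.+1 then seq_expr [seq tree_expr a' (fun w => g (i :: w)) | i <- enum 'I_q]
  else g [::].

(** As arities are bounded by a constant, a program can have separate code for each
    of them, selected by the length of a scope. *)
Fixpoint dispatch v fuel j (cs : nat -> cmd) : cmd :=
  if fuel is fuel'.+1 then CIf (iter j ETl (EVar v)) (dispatch v fuel' j.+1 cs) (cs j)
  else CSkip.

Definition drop_cmd v i : cmd :=
  CWhile (ELe (EConst 1) (EVar i))
    (v <~ ETl (EVar v) ;; i <~ ESub (EVar i) (EConst 1)).

Section Data.
Variables (F : realFieldType) (sz : F -> nat).
Implicit Types (s : store F) (L : seq (data F)).

Fixpoint tree q a (g : seq 'I_q -> data F) : data F :=
  if a is a'.+1 then enc_seq [seq tree a' (fun w => g (i :: w)) | i <- enum 'I_q]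
  else g [::].

Lemma eval_cost_arith_free e s : arith_free e -> eval_cost sz e s = expr_size e.
Proof.
elim: e => //= [e1 IH1 e2 IH2 /andP[/IH1-> /IH2->]|e IHe|e IHe|e IHe] // /IHe->//.
Qed.

Lemma arith_free_iter_tl e i : arith_free (iter i ETl e) = arith_free e.
Proof. by elim: i. Qed.

Lemma expr_size_iter_tl e i : expr_size (iter i ETl e) = (i + expr_size e)%N.
Proof. by elim: i => //= i ->. Qed.

Lemma arith_free_seq es : arith_free (seq_expr es) = all arith_free es.
Proof. by elim: es => //= e es ->. Qed.

Lemma eval_seq es s : eval (seq_expr es) s = enc_seq [seq eval e s | e <- es].
Proof. by elim: es => //= e es ->. Qed.

Lemma arith_free_tree q a (g : seq 'I_q -> expr) :
  (forall w, arith_free (g w)) -> arith_free (tree_expr a g).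
Proof.
elim: a g => //= a IHa g gP; rewrite arith_free_seq all_map.
by apply/allP => i _; exact: IHa.
Qed.

Lemma eval_tree q a (g : seq 'I_q -> expr) s :
  eval (tree_expr a g) s = tree a (fun w => eval (g w) s).
Proof.
elim: a g => //= a IHa g; rewrite eval_seq -map_comp.
by congr enc_seq; apply: eq_map => i /=; rewrite IHa.
Qed.

Lemma eq_tree q a (g h : seq 'I_q -> data F) :
  (forall w, size w = a -> g w = h w) -> tree a g = tree a h.
Proof.
elim: a g h => /= [|a IHa] g h gh; first exact: gh.
by congr enc_seq; apply: eq_map => i; apply: IHa => w sw; apply: gh; rewrite /= sw.
Qed.

Lemma eval_iter_tl e i s L : eval e s = enc_seq L ->
  eval (iter i ETl e) s = enc_seq (drop i L).
Proof.
move=> eL; elim: i => [|i IHi]; first by rewrite drop0.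
by rewrite /= IHi -addn1 addnC -drop_drop; case: (drop i L) => //= a l; rewrite drop0.
Qed.

Lemma eval_nth e i s L : eval e s = enc_seq L -> (i < size L)%N ->
  eval (nth_expr e i) s = nth leaf L i.
Proof. by move=> eL iL /=; rewrite (eval_iter_tl _ eL) (drop_nth leaf iL). Qed.

Lemma truth_iter_tl v i s L : s v = enc_seq L ->
  truth (eval (iter i ETl (EVar v)) s) = (i < size L)%N.
Proof.
move=> sL; rewrite (@eval_iter_tl _ _ _ L) // -subn_gt0 -size_drop.
by case: (drop i L).
Qed.

Lemma runs_dispatch v fuel j cs s s' L b : s v = enc_seq L ->
  (j <= size L < j + fuel)%N -> runs sz (cs (size L)) s s' b ->
  runs sz (dispatch v fuel j cs) s s' (fuel * (j + fuel + 2) + b).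
Proof.
move=> sL; elim: fuel j => [|fuel IH] j jL run; first by lia.
have cost : eval_cost sz (iter j ETl (EVar v)) s = j.+1.
  by rewrite eval_cost_arith_free ?arith_free_iter_tl // expr_size_iter_tl addn1.
have [ltj|gej] := ltnP j (size L).
  apply: runs_leq (runs_if _) _.
    rewrite (truth_iter_tl _ sL) ltj; apply: IH run; lia.
  by rewrite cost; nia.
apply: runs_leq (runs_if _) _.
  rewrite (truth_iter_tl _ sL) ltnNge gej /=.
  by rewrite (_ : j = size L) //; [exact: run | lia].
by rewrite cost; nia.
Qed.

Lemma data_size_seq L :
  data_size sz (enc_seq L) = (1 + \sum_(d <- L) (data_size sz d).+1)%N.
Proof.
by elim: L => [|d L IHL]; rewrite ?big_nil // big_cons /= IHL; lia.
Qed.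

Variable c0 : nat.
Hypothesis tame_sz : tame sz c0.

Let sz_nat m : (sz m%:R <= m + c0)%N. Proof. by case: tame_sz. Qed.

Definition drop_bound m : nat := (m.+1 * (13 + 4 * c0 + 2 * m))%N.

Lemma runs_drop v i s L m : v != i -> s v = enc_seq L -> s i = enc_nat F m ->
  runs sz (drop_cmd v i) s (update (update s v (enc_seq (drop m L))) i (enc_nat F 0))
    (drop_bound m).
Proof.
move=> vi; rewrite /drop_bound.
have sz1 : (sz 1%:~R <= 1 + c0)%N := sz_nat 1.
have le1 m' : ((1%:~R : F) <= m'%:R) = (0 < m')%N by rewrite -[1%:~R]/(1%:R) ler_nat.
elim: m L s => [|m IHm] L s sv si.
  rewrite drop0 (update_same (esym sv)) (update_same (esym si)).
  apply: runs_while_end => /=; rewrite si /= ?le1 //.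
  by have := sz1; have := sz_nat 0; lia.
have drop_behead : drop m.+1 L = drop m (behead L) by case: (L).
pose s1 := update (update s v (enc_seq (behead L))) i (enc_nat F m).
have run1 : runs sz (v <~ ETl (EVar v) ;; i <~ ESub (EVar i) (EConst 1)) s s1
    (3 + (4 + sz m.+1%:R + sz 1%:~R)).
  apply: runs_seq; first exact: runs_assign.
  have s1i : update s v (eval (ETl (EVar v)) s) i = enc_nat F m.+1.
    by rewrite /update eq_sym (negbTE vi).
  apply: runs_assign_eq; rewrite /= s1i /=; last by lia.
  rewrite sv /s1; congr (update (update _ _ _) _ (Defs.Num _)); first by case: (L).
  by rewrite -[1%:~R]/(1%:R) -natrB // subSS subn0.
have := IHm (behead L) s1.
rewrite {1 2}/s1 {1}/update (negbTE vi) {1}/update eqxx {1}/update eqxx.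
move=> /(_ erefl erefl) run2.
apply: runs_leq.
  have -> : update (update s v (enc_seq (drop m.+1 L))) i (enc_nat F 0) =
      update (update s1 v (enc_seq (drop m (behead L)))) i (enc_nat F 0).
    apply: functional_extensionality => x; rewrite /s1 /update.
    by case: eqP => // _; case: eqP => // _; rewrite drop_behead.
  apply: runs_while_step run1 run2 => /=; first by rewrite si /= le1.
  by rewrite si.
by have := sz1; have := sz_nat m.+1; rewrite /=; nia.
Qed.
End Data.

(** * Evaluating a solution *)

Arguments dispatch : simpl never.
Section Evaluation.
Variables (F : realFieldType) (sz : F -> nat) (c0 : nat).
Hypothesis tame_sz : tame sz c0.
Variables (k q : nat).

Definition table_index q a (w : seq 'I_q) : nat :=
  index w [seq val t | t <- enum {: a.-tuple 'I_q}].

Definition lookup_tree a : expr :=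
  tree_expr a (fun w : seq 'I_q => nth_expr (EVar 6) (table_index a w)).

(** Registers: 0 the remaining constraints, 1 the value accumulated so far, 2 the
    solution, 3 the remaining scope of the current constraint, 4 and 5 scratch for
    [drop_cmd], 6 the subtree reached in the table of the current constraint. *)
Definition walk_cmd : cmd :=
  4 <~ EVar 2 ;; 5 <~ EHd (EVar 3) ;; drop_cmd 4 5 ;;
  5 <~ EHd (EVar 4) ;; drop_cmd 6 5 ;; 6 <~ EHd (EVar 6) ;;
  4 <~ ENil ;; 5 <~ ENil ;; 3 <~ ETl (EVar 3).

Definition constraint_cmd : cmd :=
  3 <~ EHd (ETl (EHd (EVar 0))) ;; 6 <~ EHd (ETl (ETl (EHd (EVar 0)))) ;;
  dispatch 3 k.+1 0 (fun a => 6 <~ lookup_tree a) ;;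
  CWhile (EVar 3) walk_cmd ;;
  1 <~ EAdd (EVar 1) (EMul (EHd (EHd (EVar 0))) (EVar 6)) ;;
  6 <~ ENil ;; 0 <~ ETl (EVar 0).

Definition value_cmd : cmd :=
  1 <~ EConst 0 ;; CWhile (EVar 0) constraint_cmd.

Lemma drop_bound_mono m m' : (m <= m')%N -> (drop_bound c0 m <= drop_bound c0 m')%N.
Proof. by rewrite /drop_bound => mm; apply: leq_mul => //; lia. Qed.

Lemma table_index_lt a (t : a.-tuple 'I_q) :
  (table_index a t < size (enum {: a.-tuple 'I_q}))%N.
Proof. by rewrite -[X in (_ < X)%N](size_map val) index_mem map_f // mem_enum. Qed.

Lemma nth_table_index a (t : a.-tuple 'I_q) (T : Type) (g : a.-tuple 'I_q -> T) z :
  nth z [seq g t | t <- enum {: a.-tuple 'I_q}] (table_index a t) = g t.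
Proof.
rewrite (nth_map t) ?table_index_lt // /table_index index_map; last exact: val_inj.
by rewrite nth_index // mem_enum.
Qed.

(** One step down the tree: the subtree for words extending [pre] is replaced by
    that for words extending [pre] followed by the symbol of the variable [i]. *)
Lemma runs_walk n (x : n.-tuple 'I_q) a (g : seq 'I_q -> data F) pre (i : 'I_n) l C V h :
  runs sz walk_cmd
    (C ::: V ::: enc_solution F x ::: enc_seq [seq enc_nat F j | j : 'I_n <- i :: l] :::
      leaf ::: leaf ::: tree a.+1 (fun w => g (pre ++ w)) ::: h)
    (C ::: V ::: enc_solution F x ::: enc_seq [seq enc_nat F j | j : 'I_n <- l] :::
      leaf ::: leaf ::: tree a (fun w => g (rcons pre (tnth x i) ++ w)) ::: h)
    (30 + drop_bound c0 n + drop_bound c0 q).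
Proof.
apply: runs_leq.
apply: runs_assign_seq; rewrite /= !update_scons.
apply: runs_assign_seq; rewrite /= !update_scons.
apply: runs_seq.
  exact: (runs_drop tame_sz (m := i) (L := [seq enc_nat F v | v : 'I_q <- x])).
rewrite !update_scons.
have -> : enc_seq (drop i [seq enc_nat F v | v : 'I_q <- x]) =
    Pair (enc_nat F (tnth x i)) (enc_seq (drop i.+1 [seq enc_nat F v | v : 'I_q <- x])).
  rewrite (drop_nth leaf) ?size_map ?size_tuple //.
  by rewrite (nth_map (tnth x i)) ?size_tuple // -tnth_nth.
apply: runs_assign_seq; rewrite /= !update_scons.
apply: runs_seq; first exact: (runs_drop tame_sz (m := tnth x i)).
rewrite !update_scons.
set v := tnth x i.
pose L := [seq tree a (fun w => g (pre ++ j :: w)) | j <- enum 'I_q].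
have dropL : enc_seq (drop v L) = Pair (tree a (fun w => g (rcons pre v ++ w)))
    (enc_seq (drop v.+1 L)).
  have vq : (v < size (enum 'I_q))%N by rewrite size_enum_ord.
  have vL : (v < size L)%N by rewrite size_map.
  rewrite (drop_nth leaf vL) {1}/L (nth_map v) // nth_ord_enum.
  by congr (Pair _ _); apply: eq_tree => w _; rewrite cat_rcons.
rewrite -/L dropL.
do 3 (apply: runs_assign_seq; rewrite /= !update_scons).
apply: runs_assign_eq; last exact: leqnn.
by rewrite /= !update_scons.
rewrite /=.
have := drop_bound_mono (ltnW (ltn_ord i)).
have := drop_bound_mono (ltnW (ltn_ord (tnth x i))).
lia.
Qed.

Variable I : csp F k q.

Definition term (x : (nvars I).-tuple 'I_q) (c : constraint F k q (nvars I)) : F :=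
  weight c * func c (map_tuple (tnth x) (scope c)).

Local Notation N := (data_size sz (enc_csp I)).

Lemma data_size_csp : N = (4 + data_size sz (of_bool F (maximizing I)) +
  data_size sz (enc_seq [seq enc_nat F i | i : 'I_(nvars I)]) +
  (1 + \sum_(c <- constraints I) (data_size sz (enc_constraint c)).+1))%N.
Proof.
rewrite /enc_csp data_size_seq !big_cons big_nil.
by rewrite (data_size_seq _ [seq enc_constraint c | c <- _]) big_map; lia.
Qed.

Lemma nvars_le_size : (nvars I <= N)%N.
Proof.
rewrite data_size_csp data_size_seq big_map.
apply: (@leq_trans (\sum_(i <- enum 'I_(nvars I)) (data_size sz (enc_nat F i)).+1)).
  apply: (@leq_trans (\sum_(i <- enum 'I_(nvars I)) 1)); last exact: leq_sum.
  by rewrite sum1_size size_enum_ord.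
lia.
Qed.

Lemma constraints_le_size :
  (\sum_(c <- constraints I) (data_size sz (enc_constraint c)).+1 <= N)%N.
Proof. by rewrite data_size_csp; lia. Qed.

Lemma constraint_le_size pre c l : pre ++ c :: l = constraints I ->
  (data_size sz (enc_constraint c) < N)%N.
Proof.
move=> preE; apply: leq_trans constraints_le_size; rewrite -preE big_cat big_cons.
exact: leq_trans (leq_addr _ _) (leq_addl _ _).
Qed.

Lemma size_constraints_le : (size (constraints I) <= N)%N.
Proof.
apply: leq_trans constraints_le_size; rewrite -sum1_size.
exact: leq_sum.
Qed.

Lemma func_le_size n (c : constraint F k q n) t :
  (sz (weight c) + sz (func c t) < data_size sz (enc_constraint c))%N.
Proof.
rewrite /enc_constraint data_size_seq !big_cons big_nil !data_size_seq !big_map.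
by rewrite (bigD1_seq t) -?enumT ?mem_enum ?enum_uniq //=; lia.
Qed.

Lemma value_term (x : (nvars I).-tuple 'I_q) : value x = \sum_(c <- constraints I) term x c.
Proof. by []. Qed.

Lemma sum_size_term (x : (nvars I).-tuple 'I_q) (s : seq (constraint F k q (nvars I))) :
  (\sum_(c <- s) (sz (term x c)).+1 <=
    c0.+1 * \sum_(c <- s) (data_size sz (enc_constraint c)).+1)%N.
Proof.
case: tame_sz => _ szM _; rewrite big_distrr; apply: leq_sum => c _.
have := szM (weight c) (func c (map_tuple (tnth x) (scope c))).
have := func_le_size (map_tuple (tnth x) (scope c)); rewrite -/(term x c).
move: (data_size _ _) (sz (term x c)) => D s1 /=; nia.
Qed.

Definition value_size (m : nat) : nat := (2 * (c0.+1 * m) + c0)%N.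

(** The numbers held in the accumulator stay linear in the size of the instance, as
    each weight and each table entry of a term is part of the encoding. *)
Lemma sz_partial_value (x : (nvars I).-tuple 'I_q) pre l :
  pre ++ l = constraints I -> (sz (\sum_(c <- pre) term x c) <= value_size N)%N.
Proof.
move=> preE; case: tame_sz => _ _ szS.
have := szS [seq term x c | c <- pre]; rewrite !big_map => /leq_trans-> //.
rewrite leq_add2r leq_mul2l /=; apply: leq_trans (sum_size_term _ _) _.
rewrite leq_mul2l /=; apply: leq_trans constraints_le_size.
by rewrite -preE big_cat leq_addr.
Qed.

(** The expressions for the various arities have a constant size, [k] and [q] being
    constants of the problem. *)
Definition max_tree_size : nat := \max_(a < k.+1) expr_size (lookup_tree a).

Definition constraint_bound (m : nat) : nat :=
  (k.+1 * (k + 3) + max_tree_size + k.+1 * (32 + drop_bound c0 m + drop_bound c0 q)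
   + 3 * value_size m + c0 + 100)%N.

Definition lookup (c : constraint F k q (nvars I)) (w : seq 'I_q) : data F :=
  nth leaf [seq Defs.Num (func c t) | t : (arity c).-tuple 'I_q] (table_index (arity c) w).

Lemma lookupE (c : constraint F k q (nvars I)) (t : (arity c).-tuple 'I_q) :
  lookup c t = Defs.Num (func c t).
Proof. exact: nth_table_index. Qed.

Lemma arity_lt (c : constraint F k q (nvars I)) : (arity c < k.+1)%N.
Proof. by have := arity_bounds c; lia. Qed.

Lemma runs_lookup_tree (c : constraint F k q (nvars I)) s :
  s 6%N = enc_seq [seq Defs.Num (func c t) | t : (arity c).-tuple 'I_q] ->
  runs sz (6 <~ lookup_tree (arity c)) s (update s 6 (tree (arity c) (lookup c)))
    (1 + max_tree_size).
Proof.
move=> s6; apply: runs_assign_eq.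
  congr (update _ _ _); rewrite eval_tree; apply: eq_tree => w /eqP sw.
  symmetry; apply: (@eval_nth _ (EVar 6) _ _ _ s6).
  by rewrite size_map -[w]/(val (Tuple sw)); exact: table_index_lt.
rewrite eval_cost_arith_free; last first.
  by apply: arith_free_tree => w /=; rewrite arith_free_iter_tl.
rewrite leq_add2l.
exact: (@leq_bigmax _ (fun a : 'I_k.+1 => expr_size (lookup_tree a)) (Ordinal (arity_lt c))).
Qed.

Lemma runs_walk_all n (x : n.-tuple 'I_q) (g : seq 'I_q -> data F) a (sc : a.-tuple 'I_n)
    C V h :
  runs sz (CWhile (EVar 3) walk_cmd)
    (C ::: V ::: enc_solution F x ::: enc_seq [seq enc_nat F j | j : 'I_n <- sc] :::
      leaf ::: leaf ::: tree a g ::: h)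
    (C ::: V ::: enc_solution F x ::: leaf :::
      leaf ::: leaf ::: g [seq tnth x i | i <- sc] ::: h)
    (a.+1 * (32 + drop_bound c0 n + drop_bound c0 q)).
Proof.
pose st pre (l : seq 'I_n) := C ::: V ::: enc_solution F x :::
  enc_seq [seq enc_nat F j | j : 'I_n <- l] :::
  leaf ::: leaf ::: tree (size l) (fun w => g (pre ++ w)) ::: h.
have foldl_rcons (r : seq 'I_n) pre : foldl (fun pre i => rcons pre (tnth x i)) pre r =
    pre ++ [seq tnth x i | i <- r].
  by elim: r pre => [|i r IHr] pre /=; rewrite ?cats0 // IHr cat_rcons.
have := @runs_foreach _ sz _ _ (fun _ _ => True) (fun pre i => rcons pre (tnth x i)) st 3
  walk_cmd (30 + drop_bound c0 n + drop_bound c0 q) [::] sc.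
rewrite foldl_rcons /st /= cats0 !addnA size_tuple; apply=> // pre i l _; split=> //.
exact: runs_walk.
Qed.

Lemma runs_constraint (x : (nvars I).-tuple 'I_q) c l h pre :
  pre ++ c :: l = constraints I ->
  runs sz constraint_cmd
    (enc_seq [seq enc_constraint c | c <- c :: l] :::
      Defs.Num (\sum_(c <- pre) term x c) ::: enc_solution F x :::
      leaf ::: leaf ::: leaf ::: leaf ::: h)
    (enc_seq [seq enc_constraint c | c <- l] :::
      Defs.Num (\sum_(c <- rcons pre c) term x c) ::: enc_solution F x :::
      leaf ::: leaf ::: leaf ::: leaf ::: h)
    (constraint_bound N).
Proof.
move=> preE; have [ar_gt0 ar_le] := andP (arity_bounds c).
apply: runs_leq.
apply: runs_assign_seq; rewrite /= !update_scons.
apply: runs_assign_seq; rewrite /= !update_scons.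
apply: runs_seq.
  apply: (@runs_dispatch _ _ _ _ _ _ _ _ [seq enc_nat F i | i : 'I_(nvars I) <- scope c]).
  - by [].
  - by rewrite size_map size_tuple; lia.
  by rewrite size_map size_tuple; exact: runs_lookup_tree.
rewrite !update_scons; apply: runs_seq.
  exact: runs_walk_all.
have -> : lookup c [seq tnth x i | i <- scope c] =
    Defs.Num (func c (map_tuple (tnth x) (scope c))) by rewrite -lookupE.
do 2 (apply: runs_assign_seq; rewrite /= !update_scons).
apply: runs_assign_eq; last exact: leqnn.
by rewrite /= !update_scons -cats1 big_cat big_seq1.
set B := constraint_bound N; rewrite /=.
have sz_acc := sz_partial_value x preE.
have [_ szM _] := tame_sz.
have sz_prod := szM (weight c) (func c (map_tuple (tnth x) (scope c))).
have sz_wf : (sz (weight c) + sz (func c (map_tuple (tnth x) (scope c))) <= value_size N)%N.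
  apply: leq_trans (ltnW (func_le_size _)) _.
  apply: leq_trans (ltnW (constraint_le_size preE)) _.
  by rewrite /value_size; move: N => M; nia.
have drop_n : (drop_bound c0 (nvars I) <= drop_bound c0 N)%N.
  exact/drop_bound_mono/nvars_le_size.
have walk : ((arity c).+1 * (32 + drop_bound c0 (nvars I) + drop_bound c0 q) <=
    k.+1 * (32 + drop_bound c0 N + drop_bound c0 q))%N.
  by rewrite leq_mul ?arity_lt // leq_add2r leq_add2l.
rewrite -/(term x c) in sz_prod *; rewrite /B /constraint_bound.
rewrite (_ : 0 + k.+1 + 2 = k + 3)%N; last by lia.
move: walk sz_acc sz_prod sz_wf.
move: (_ * (32 + _ + _))%N (_ * (32 + _ + _))%N (k.+1 * (k + 3))%N => w1 w2 w3.
move: (sz _) (sz _) (sz _) (sz _) => z1 z2 z3 z4; lia.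
Qed.

Definition value_bound (m : nat) : nat := (m.+1 * (constraint_bound m + 4))%N.

Lemma runs_value (x : (nvars I).-tuple 'I_q) d h :
  runs sz value_cmd
    (enc_seq [seq enc_constraint c | c <- constraints I] ::: d ::: enc_solution F x :::
      leaf ::: leaf ::: leaf ::: leaf ::: h)
    (leaf ::: Defs.Num (value x) ::: enc_solution F x :::
      leaf ::: leaf ::: leaf ::: leaf ::: h)
    (value_bound N).
Proof.
pose st pre (l : seq (constraint F k q (nvars I))) :=
  enc_seq [seq enc_constraint c | c <- l] ::: Defs.Num (\sum_(c <- pre) term x c) :::
  enc_solution F x ::: leaf ::: leaf ::: leaf ::: leaf ::: h.
have foldl_rcons (T : Type) (l pre : seq T) : foldl rcons pre l = pre ++ l.
  by elim: l pre => [|c l IHl] pre /=; rewrite ?cats0 // IHl cat_rcons.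
have := @runs_foreach _ sz _ _ (fun pre l => pre ++ l = constraints I) rcons st 0
  constraint_cmd (constraint_bound N) [::] (constraints I).
rewrite foldl_rcons /st /= big_nil => run.
apply: runs_leq.
  apply: runs_assign_seq; rewrite /= !update_scons; apply: run => // pre c l preE.
  by rewrite cat_rcons; split=> //; exact: runs_constraint.
have := size_constraints_le; rewrite /value_bound /=.
move: (size _) (constraint_bound _) N => m b M; nia.
Qed.

End Evaluation.

(** * Polynomial bounds *)

Definition poly_bounded (f : nat -> nat) : Prop :=
  exists a, forall m, (f m <= a * m ^ a + a)%N.

(** The additional 1 is for [m = 0], where [0 ^ 0 = 1] exceeds the higher powers. *)
Lemma expn_le_expn1 m a b : (a <= b)%N -> (m ^ a <= m ^ b + 1)%N.
Proof.
case: m => [|m] ab; first by case: a ab => [|a] ab; rewrite ?(@exp0n a.+1) // expn0 addn1.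
by apply: leq_trans (leq_addr _ _); rewrite leq_pexp2l.
Qed.

Lemma poly_bounded_leq f c d e : (forall m, f m <= c * m ^ d + e)%N -> poly_bounded f.
Proof.
move=> fP; exists (c + d + e)%N => m; apply: leq_trans (fP m) _.
have : (m ^ d <= m ^ (c + d + e) + 1)%N by apply: expn_le_expn1; lia.
move: (m ^ d)%N (m ^ _)%N => x y; nia.
Qed.

Lemma poly_bounded_const c : poly_bounded (fun=> c).
Proof. by apply: (@poly_bounded_leq _ 0 0 c) => m; lia. Qed.

Lemma poly_bounded_id : poly_bounded id.
Proof. by apply: (@poly_bounded_leq _ 1 1 0) => m; rewrite expn1; lia. Qed.

Lemma poly_bounded_add f g :
  poly_bounded f -> poly_bounded g -> poly_bounded (fun m => f m + g m)%N.
Proof.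
move=> [a fa] [b gb]; apply: (@poly_bounded_leq _ (a + b) (a + b) (2 * (a + b))) => m.
have := @expn_le_expn1 m a (a + b) ltac:(lia).
have := @expn_le_expn1 m b (a + b) ltac:(lia).
have := fa m; have := gb m.
move: (m ^ a)%N (m ^ b)%N (m ^ _)%N => x y z; nia.
Qed.

Lemma poly_bounded_mul f g :
  poly_bounded f -> poly_bounded g -> poly_bounded (fun m => f m * g m)%N.
Proof.
move=> [a fa] [b gb].
apply: (@poly_bounded_leq _ (3 * (a * b)) (a + b) (3 * (a * b))) => m.
apply: leq_trans (leq_mul (fa m) (gb m)) _.
have := @expn_le_expn1 m a (a + b) ltac:(lia).
have := @expn_le_expn1 m b (a + b) ltac:(lia).
have -> : ((a * m ^ a + a) * (b * m ^ b + b) =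
  a * b * (m ^ (a + b) + m ^ a + m ^ b + 1))%N by rewrite expnD; lia.
have -> : (3 * (a * b) * m ^ (a + b) + 3 * (a * b) = a * b * (3 * m ^ (a + b) + 3))%N by lia.
move=> xb xa; rewrite leq_mul2l; apply/orP; right.
by move: xa xb; move: (m ^ a)%N (m ^ b)%N (m ^ _)%N => x y z; lia.
Qed.

Lemma poly_bounded_exp f a : poly_bounded f -> poly_bounded (fun m => f m ^ a)%N.
Proof.
move=> fP; elim: a => [|a IHa].
  by have [c cP] := poly_bounded_const 1; exists c => m; rewrite expn0.
by have [c cP] := poly_bounded_mul fP IHa; exists c => m; rewrite expnS.
Qed.

Lemma poly_bounded_succ : poly_bounded S.
Proof. by apply: (@poly_bounded_leq _ 1 1 1) => m; rewrite expn1; lia. Qed.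

Ltac poly_step := first
  [ exact: poly_bounded_const | exact: poly_bounded_id | exact: poly_bounded_succ
  | apply: poly_bounded_add | apply: poly_bounded_mul | apply: poly_bounded_exp ].

Lemma poly_drop_bound c0 : poly_bounded (drop_bound c0).
Proof.
by rewrite /drop_bound; repeat poly_step.
Qed.

(** * Keeping the better of two solutions *)

Section Solvers.
Variables (F : realFieldType) (sz : F -> nat) (c0 : nat).
Hypothesis tame_sz : tame sz c0.

(** The shape of [approximable] with an arbitrary guarantee on the output. *)
Definition solver k q (Rel : forall I : csp F k q, (nvars I).-tuple 'I_q -> Prop) : Prop :=
  exists (prog : cmd) (a : nat), forall I : csp F k q,
    exists (s : store F) (t : nat) (x : (nvars I).-tuple 'I_q),
      [/\ exec sz prog (input_store (enc_csp I)) s t,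
          (t <= a * data_size sz (enc_csp I) ^ a + a)%N,
          s 0%N = enc_solution F x
        & Rel I x].

Lemma runs_rename f E c s s' b : embedding f E ->
  runs sz c s s' b -> runs sz (rename f c) (E s) (E s') b.
Proof. by move=> fE [t ct tb]; exists t => //; exact: exec_rename. Qed.

Lemma runs_shift l c s s' b : runs sz c s s' b ->
  runs sz (iter (size l) (rename S) c) (foldr scons s l) (foldr scons s' l) b.
Proof.
by move=> run; elim: l => //= d l IHl; exact: (runs_rename (embedding_scons d)).
Qed.

Lemma poly_value_bound k q : poly_bounded (value_bound c0 k q).
Proof.
rewrite /value_bound /constraint_bound /value_size.
by repeat first [exact: poly_drop_bound | poly_step].
Qed.

(** Registers 0 to 6 are those of [value_cmd].  Register 7 keeps the instance and 8
    the value of the first solution.  From 9 on, the even and odd positions are the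
    private registers of the two programs, so that 9 and 10 are their inputs and
    then their outputs. *)
Definition compare_cmd : cmd :=
  CIf (EHd (EVar 7))
    (CIf (ELe (EVar 1) (EVar 8)) (0 <~ EVar 9) (0 <~ EVar 10))
    (CIf (ELe (EVar 8) (EVar 1)) (0 <~ EVar 9) (0 <~ EVar 10)).

Definition best_cmd k q (prog1 prog2 : cmd) : cmd :=
  7 <~ EVar 0 ;; 9 <~ EVar 0 ;; 10 <~ EVar 0 ;;
  iter 9 (rename S) (rename double prog1) ;;
  iter 9 (rename S) (rename (fun x => x.*2.+1) prog2) ;;
  0 <~ EHd (ETl (ETl (EVar 7))) ;; 2 <~ EVar 9 ;; value_cmd k q ;; 8 <~ EVar 1 ;;
  0 <~ EHd (ETl (ETl (EVar 7))) ;; 2 <~ EVar 10 ;; value_cmd k q ;;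
  compare_cmd.

Lemma runs_compare k q (I : csp F k q) (x1 x2 : (nvars I).-tuple 'I_q) d0 d2 h1 h2 :
  exists2 x, at_least_as_good x x1 /\ at_least_as_good x x2 &
  runs sz compare_cmd
    (d0 ::: Defs.Num (value x2) ::: d2 ::: leaf ::: leaf ::: leaf ::: leaf :::
     enc_csp I ::: Defs.Num (value x1) ::: enc_solution F x1 ::: enc_solution F x2 :::
     interleave h1 h2)
    (enc_solution F x ::: Defs.Num (value x2) ::: d2 ::: leaf ::: leaf ::: leaf ::: leaf :::
     enc_csp I ::: Defs.Num (value x1) ::: enc_solution F x1 ::: enc_solution F x2 :::
     interleave h1 h2)
    (20 + 2 * value_size c0 (data_size sz (enc_csp I))).
Proof.
have szV (x : (nvars I).-tuple 'I_q) :
    (sz (value x) <= value_size c0 (data_size sz (enc_csp I)))%N.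
  by rewrite value_term; apply: sz_partial_value (cats0 _).
have V1 := szV x1; have V2 := szV x2; move: (value_size _ _) V1 V2 => V V1 V2.
exists (if (if maximizing I then value x2 <= value x1 else value x1 <= value x2)
        then x1 else x2).
  rewrite /at_least_as_good; case: (maximizing I).
    by case: (leP (value x2) (value x1)) => [le|/ltW le]; split.
  by case: (leP (value x1) (value x2)) => [le|/ltW le]; split.
apply: runs_leq.
  apply: runs_if; rewrite /=.
  case: (maximizing I) => /=.
    apply: (@runs_leq _ _ _ _ _ _ (10 + 2 * V)).
      apply: runs_if; rewrite /=.
      by case: (value x2 <= value x1); apply: runs_assign_eq; rewrite /= ?update_scons0.
    by rewrite /=; lia.
  apply: (@runs_leq _ _ _ _ _ _ (10 + 2 * V)).
    apply: runs_if; rewrite /=.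
    by case: (value x1 <= value x2); apply: runs_assign_eq; rewrite /= ?update_scons0.
  by rewrite /=; lia.
by rewrite /=; lia.
Qed.

Lemma solver_best k q (Rel1 Rel2 : forall I : csp F k q, (nvars I).-tuple 'I_q -> Prop) :
  solver Rel1 -> solver Rel2 ->
  solver (fun I x => exists x1 x2, [/\ Rel1 I x1, Rel2 I x2,
    at_least_as_good x x1 & at_least_as_good x x2]).
Proof.
move=> [prog1 [a1 P1]] [prog2 [a2 P2]].
pose bound m := ((a1 * m ^ a1 + a1) + (a2 * m ^ a2 + a2) + 2 * value_bound c0 k q m +
  2 * value_size c0 m + 100)%N.
have [a boundP] : poly_bounded bound.
  rewrite /bound /value_size.
  by repeat first [exact: poly_value_bound | poly_step].
exists (best_cmd k q prog1 prog2), a => I.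
have [sA [tA [x1 [execA tA_le sA0 rel1]]]] := P1 I.
have [sB [tB [x2 [execB tB_le sB0 rel2]]]] := P2 I.
have store_eta (s : store F) : s = s 0%N ::: (fun y => s y.+1).
  by apply: functional_extensionality => -[].
have [x [good1 good2]] := runs_compare x1 x2 leaf (enc_solution F x2)
  (fun y => sA y.+1) (fun y => sB y.+1).
set st := (X in runs _ _ _ X _); have st0 : st 0%N = enc_solution F x by [].
move: st st0 => st st0; rewrite -interleave_scons -sA0 -sB0 -!store_eta => runC.
set N := data_size sz (enc_csp I) in boundP tA_le tB_le runC *.
suff [t exect t_le] : runs sz (best_cmd k q prog1 prog2) (input_store (enc_csp I)) st (bound N).
  exists st, t, x; split; [exact: exect | exact: leq_trans (boundP N) | exact: st0 |].
  by exists x1, x2.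
have runA : runs sz prog1 (input_store (enc_csp I)) sA (a1 * N ^ a1 + a1) by exists tA.
have runB : runs sz prog2 (input_store (enc_csp I)) sB (a2 * N ^ a2 + a2) by exists tB.
set l := [:: enc_csp I; leaf; leaf; leaf; leaf; leaf; leaf; enc_csp I; leaf].
have {}runA := runs_shift l (runs_rename (embedding_left (input_store (enc_csp I))) runA).
have {}runB := runs_shift l (runs_rename (embedding_right sA) runB).
rewrite !input_storeE interleave_scons interleave_empty /= in runA.
rewrite !input_storeE /= in runB.
have runV y d h := runs_value tame_sz (I := I) y d h; rewrite -/N in runV.
have out1 : interleave sA sB 0%N = enc_solution F x1 by [].
have out2 : interleave sA sB 1%N = enc_solution F x2 by [].
apply: runs_leq.
  (* Expose the eleven registers that the program names. *)
  rewrite input_storeE; do 10 rewrite {1}empty_storeE.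
  do 3 (apply: runs_assign_seq; rewrite /= !update_scons).
  apply: runs_seq; first exact: runA.
  apply: runs_seq; first exact: runB.
  do 2 (apply: runs_assign_seq; rewrite /= !update_scons).
  apply: runs_seq.
    by rewrite out1; exact: runV.
  do 3 (apply: runs_assign_seq; rewrite /= !update_scons).
  apply: runs_seq; last exact: runC.
  by rewrite out2 sB0; exact: runV.
set B := bound N; rewrite /= /B /bound; lia.
Qed.
End Solvers.

(** * Solving restrictions to a smaller alphabet *)

Lemma foldl_cons_rev (T : Type) (l acc : seq T) :
  foldl (fun acc c => c :: acc) acc l = rev l ++ acc.
Proof. by elim: l acc => //= c l IHl acc; rewrite IHl rev_cons cat_rcons. Qed.

Section RestrictionProgram.
Variables (F : realFieldType) (sz : F -> nat) (c0 : nat).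
Hypothesis tame_sz : tame sz c0.
Variables (k p q : nat) (f : 'I_p -> 'I_q).

Definition restrict_constraint n (c : constraint F k q n) : constraint F k p n :=
  @Constraint F k p n (weight c) (arity c) (scope c) (fun t => func c (map_tuple f t))
    (weight_gt0 c) (arity_bounds c) (scope_increasing c).

Lemma restrict_constraints_gt0 (I : csp F k q) :
  (0 < size (rev (map (@restrict_constraint (nvars I)) (constraints I))))%N.
Proof. by rewrite size_rev size_map constraints_gt0. Qed.

(** The constraints are listed in reverse order, as the program builds them by
    consing onto an accumulator. *)
Definition restrict_csp (I : csp F k q) : csp F k p :=
  Csp (maximizing I) (nvars_gt0 I) (restrict_constraints_gt0 I).

Lemma value_restrict (I : csp F k q) (y : (nvars I).-tuple 'I_p) :
  value (I := restrict_csp I) y = value (map_tuple f y).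
Proof.
rewrite /value /restrict_csp /= big_rev big_map.
apply: eq_bigr => c _; congr (_ * func c _); apply: eq_from_tnth => i.
by rewrite !tnth_map.
Qed.

(** The table of the restriction is read off the original one at fixed places. *)
Definition subtable_expr a : expr :=
  seq_expr [seq nth_expr (EVar 4) (table_index a (map_tuple f t)) | t : a.-tuple 'I_p].

(** Registers: 0 the instance and finally the output, 1 the list being consumed, 2
    the list being built, 3 the scope, 4 the table, 5 the restricted table, 6 and 7
    scratch for [drop_cmd].  From 8 on lie the registers of the given program. *)
Definition restrict_constraint_cmd : cmd :=
  3 <~ EHd (ETl (EHd (EVar 1))) ;; 4 <~ EHd (ETl (ETl (EHd (EVar 1)))) ;;
  dispatch 3 k.+1 0 (fun a => 5 <~ subtable_expr a) ;;
  2 <~ ECons (seq_expr [:: EHd (EHd (EVar 1)); EVar 3; EVar 5]) (EVar 2) ;;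
  3 <~ ENil ;; 4 <~ ENil ;; 5 <~ ENil ;; 1 <~ ETl (EVar 1).

Definition embed_symbol_cmd : cmd :=
  6 <~ seq_expr [seq EConst (Posz (f i)) | i : 'I_p] ;; 7 <~ EHd (EVar 1) ;;
  drop_cmd 6 7 ;; 2 <~ ECons (EHd (EVar 6)) (EVar 2) ;;
  6 <~ ENil ;; 7 <~ ENil ;; 1 <~ ETl (EVar 1).

Definition restrict_cmd (prog : cmd) : cmd :=
  1 <~ EHd (ETl (ETl (EVar 0))) ;;
  CWhile (EVar 1) restrict_constraint_cmd ;;
  8 <~ seq_expr [:: EHd (EVar 0); EHd (ETl (EVar 0)); EVar 2] ;;
  iter 8 (rename S) prog ;;
  1 <~ EVar 8 ;; 2 <~ ENil ;;
  CWhile (EVar 1) embed_symbol_cmd ;;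
  0 <~ ENil ;;
  CWhile (EVar 2) (0 <~ ECons (EHd (EVar 2)) (EVar 0) ;; 2 <~ ETl (EVar 2)).

Definition max_subtable_size : nat := \max_(a < k.+1) expr_size (subtable_expr a).

Definition restrict_constraint_bound : nat := (k.+1 * (k + 3) + max_subtable_size + 50)%N.

Lemma eval_subtable n (c : constraint F k q n) s :
  s 4%N = enc_seq [seq Defs.Num (func c t) | t : (arity c).-tuple 'I_q] ->
  eval (subtable_expr (arity c)) s =
    enc_seq [seq Defs.Num (func (restrict_constraint c) t) | t : (arity c).-tuple 'I_p].
Proof.
move=> s4; rewrite eval_seq -map_comp; congr enc_seq; apply: eq_map => t.
rewrite [LHS](@eval_nth _ (EVar 4) _ _ _ s4); first exact: nth_table_index.
by rewrite size_map; exact: table_index_lt.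
Qed.

Lemma runs_restrict_constraint n (c : constraint F k q n) acc l D h :
  runs sz restrict_constraint_cmd
    (D ::: enc_seq [seq enc_constraint c | c <- c :: l] :::
      enc_seq [seq enc_constraint (restrict_constraint c) | c <- acc] :::
      leaf ::: leaf ::: leaf ::: h)
    (D ::: enc_seq [seq enc_constraint c | c <- l] :::
      enc_seq [seq enc_constraint (restrict_constraint c) | c <- c :: acc] :::
      leaf ::: leaf ::: leaf ::: h)
    restrict_constraint_bound.
Proof.
apply: runs_leq.
  do 2 (apply: runs_assign_seq; rewrite /= !update_scons).
  apply: runs_seq.
    apply: (@runs_dispatch _ _ _ _ _ _ _ _ [seq enc_nat F i | i : 'I_n <- scope c]).
    - by [].
    - by rewrite size_map size_tuple; have := arity_bounds c; lia.
    rewrite size_map size_tuple.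
    apply: (@runs_assign_eq _ _ _ _ _ _ (1 + max_subtable_size)); first by [].
    rewrite eval_cost_arith_free; last first.
      rewrite /subtable_expr arith_free_seq all_map; apply/allP => t _ /=.
      by rewrite arith_free_iter_tl.
    have ac : (arity c < k.+1)%N by have := arity_bounds c; lia.
    rewrite leq_add2l.
    exact: (@leq_bigmax _ (fun a : 'I_k.+1 => expr_size (subtable_expr a)) (Ordinal ac)).
  rewrite (eval_subtable (c := c)) // !update_scons.
  do 4 (apply: runs_assign_seq; rewrite /= !update_scons).
  apply: runs_assign_eq; last exact: leqnn.
  by rewrite /= !update_scons.
rewrite /restrict_constraint_bound /=.
move: max_subtable_size => m; nia.
Qed.

Lemma runs_embed_symbol (i : 'I_p) acc l D d3 d4 d5 h :
  runs sz embed_symbol_cmd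
    (D ::: enc_seq [seq enc_nat F j | j : 'I_p <- i :: l] :::
      enc_seq [seq enc_nat F (f j) | j <- acc] :::
      d3 ::: d4 ::: d5 ::: leaf ::: leaf ::: h)
    (D ::: enc_seq [seq enc_nat F j | j : 'I_p <- l] :::
      enc_seq [seq enc_nat F (f j) | j <- i :: acc] :::
      d3 ::: d4 ::: d5 ::: leaf ::: leaf ::: h)
    (50 + expr_size (seq_expr [seq EConst (Posz (f i)) | i : 'I_p]) + drop_bound c0 p).
Proof.
set e := seq_expr _.
pose L := [seq enc_nat F (f j) | j : 'I_p].
have eE s : eval e s = enc_seq L by rewrite eval_seq -map_comp.
have e_free : arith_free e by rewrite arith_free_seq all_map; apply/allP.
have dropL : enc_seq (drop i L) = Pair (enc_nat F (f i)) (enc_seq (drop i.+1 L)).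
  have iq : (i < size (enum 'I_p))%N by rewrite size_enum_ord.
  have iL : (i < size L)%N by rewrite size_map.
  by rewrite (drop_nth leaf iL) {1}/L (nth_map i) // nth_ord_enum.
rewrite /embed_symbol_cmd -/e; move: e eE e_free => e eE e_free.
apply: runs_leq.
  apply: runs_assign_seq; rewrite eE !update_scons.
  apply: runs_assign_seq; rewrite /= !update_scons.
  apply: runs_seq; first exact: (runs_drop tame_sz (m := i) (L := L)).
  rewrite !update_scons dropL.
  do 3 (apply: runs_assign_seq; rewrite /= !update_scons).
  apply: runs_assign_eq; last exact: leqnn.
  by rewrite /= !update_scons.
rewrite eval_cost_arith_free //=; have := drop_bound_mono c0 (ltnW (ltn_ord i)); lia.
Qed.

Definition size_factor : nat := (p.+1 ^ k + 4)%N.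

(** At most [p.+1 ^ k] entries are copied into the restricted table, each of them
    smaller than the encoding of the original constraint; the successor only
    avoids a special case for [p = 0]. *)
Lemma restrict_constraint_size n (c : constraint F k q n) :
  ((data_size sz (enc_constraint (restrict_constraint c))).+1 <=
    size_factor * (data_size sz (enc_constraint c)).+1)%N.
Proof.
set D := data_size sz (enc_constraint c).
set sub := (\sum_(t <- enum {: (arity c).-tuple 'I_p}) (1 + sz (func c (map_tuple f t))).+1)%N.
have sub_le : (sub <= p.+1 ^ k * D.+1)%N.
  apply: (@leq_trans (\sum_(t <- enum {: (arity c).-tuple 'I_p}) D.+1)).
    apply: leq_sum => t _; have := func_le_size sz (c := c) (map_tuple f t).
    rewrite -/D; lia.
  rewrite big_enum sum_nat_const card_tuple card_ord leq_mul2r orFb.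
  apply: (@leq_trans (p.+1 ^ arity c)).
    by case: (arity c) => // a; rewrite leq_exp2r.
  by rewrite leq_pexp2l //; have := arity_bounds c; lia.
have -> : data_size sz (enc_constraint (restrict_constraint c)) =
    (4 + (1 + sz (weight c)) + data_size sz (enc_seq [seq enc_nat F i | i : 'I_n <- scope c])
      + (1 + sub))%N.
  rewrite /enc_constraint data_size_seq !big_cons big_nil.
  by rewrite (data_size_seq _ [seq Defs.Num _ | _ : _]) big_map /= -/sub; lia.
have : (4 + (1 + sz (weight c)) + data_size sz (enc_seq [seq enc_nat F i | i : 'I_n <- scope c])
    <= D)%N.
  by rewrite /D /enc_constraint [leqRHS]data_size_seq !big_cons big_nil /=; lia.
rewrite /size_factor; move: sub_le; move: (p.+1 ^ k)%N D sub => P D sub; nia.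
Qed.

Lemma restrict_csp_size (I : csp F k q) :
  (data_size sz (enc_csp (restrict_csp I)) <= size_factor * data_size sz (enc_csp I))%N.
Proof.
rewrite !data_size_csp.
set S1 := (X in (_ + (1 + X) <= _)%N); set S2 := (X in (_ <= _ * (_ + (1 + X)))%N).
have S12 : (S1 <= size_factor * S2)%N.
  rewrite /S1 /S2 /restrict_csp [constraints _]/= big_rev big_map.
  rewrite big_distrr; apply: leq_sum => c _; exact: restrict_constraint_size.
have -> : maximizing (restrict_csp I) = maximizing I by [].
have -> : nvars (restrict_csp I) = nvars I by [].
move: S12; rewrite /size_factor; move: S1 S2 => S1 S2.
move: (data_size _ _) (data_size _ _) (p.+1 ^ k)%N => X Y P; nia.
Qed.

Definition restrict_bound (a m : nat) : nat :=
  (m.+1 * (2 + restrict_constraint_bound) + (a * (size_factor * m) ^ a + a) +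
   m.+1 * (2 + (50 + expr_size (seq_expr [seq EConst (Posz (f i)) | i : 'I_p]) +
     drop_bound c0 p)) + m.+1 * 12 + 100)%N.

Lemma runs_restrict_constraints n (cs : seq (constraint F k q n)) D h :
  runs sz (CWhile (EVar 1) restrict_constraint_cmd)
    (D ::: enc_seq [seq enc_constraint c | c <- cs] ::: leaf :::
      leaf ::: leaf ::: leaf ::: h)
    (D ::: leaf :::
      enc_seq [seq enc_constraint c | c <- rev (map (@restrict_constraint n) cs)] :::
      leaf ::: leaf ::: leaf ::: h)
    ((size cs).+1 * (2 + restrict_constraint_bound)).
Proof.
pose st (acc l : seq (constraint F k q n)) :=
  D ::: enc_seq [seq enc_constraint c | c <- l] :::
  enc_seq [seq enc_constraint (restrict_constraint c) | c <- acc] :::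
  leaf ::: leaf ::: leaf ::: h.
have := @runs_foreach _ sz _ _ (fun _ _ => True) (fun acc c => c :: acc) st 1
  restrict_constraint_cmd restrict_constraint_bound [::] cs.
rewrite foldl_cons_rev cats0 /st /= -map_rev -map_comp; apply=> // acc c l _.
by split=> //; exact: runs_restrict_constraint.
Qed.

Lemma runs_embed_solution (y : seq 'I_p) D d3 d4 d5 h :
  runs sz (CWhile (EVar 1) embed_symbol_cmd)
    (D ::: enc_seq [seq enc_nat F j | j : 'I_p <- y] ::: leaf :::
      d3 ::: d4 ::: d5 ::: leaf ::: leaf ::: h)
    (D ::: leaf ::: enc_seq [seq enc_nat F (f j) | j : 'I_p <- rev y] :::
      d3 ::: d4 ::: d5 ::: leaf ::: leaf ::: h)
    ((size y).+1 *
      (2 + (50 + expr_size (seq_expr [seq EConst (Posz (f i)) | i : 'I_p]) +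
      drop_bound c0 p))).
Proof.
set B := (50 + _ + _)%N.
pose st (acc l : seq 'I_p) := D ::: enc_seq [seq enc_nat F j | j : 'I_p <- l] :::
  enc_seq [seq enc_nat F (f j) | j <- acc] :::
  d3 ::: d4 ::: d5 ::: leaf ::: leaf ::: h.
have := @runs_foreach _ sz _ _ (fun _ _ => True) (fun acc c => c :: acc) st 1
  embed_symbol_cmd B [::] y.
rewrite foldl_cons_rev cats0 /st /=; apply=> // acc i l _.
by split=> //; exact: runs_embed_symbol.
Qed.

Lemma runs_rev (L : seq (data F)) d1 h :
  runs sz (CWhile (EVar 2) (0 <~ ECons (EHd (EVar 2)) (EVar 0) ;; 2 <~ ETl (EVar 2)))
    (leaf ::: d1 ::: enc_seq L ::: h) (enc_seq (rev L) ::: d1 ::: leaf ::: h)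
    ((size L).+1 * 12).
Proof.
pose st (acc l : seq (data F)) := enc_seq acc ::: d1 ::: enc_seq l ::: h.
have := @runs_foreach _ sz _ _ (fun _ _ => True) (fun acc c => c :: acc) st 2
  (0 <~ ECons (EHd (EVar 2)) (EVar 0) ;; 2 <~ ETl (EVar 2)) 10 [::] L.
rewrite foldl_cons_rev cats0 /st /=; apply=> // acc d l _; split=> //.
apply: runs_leq.
  apply: runs_assign_seq; rewrite /= !update_scons.
  apply: runs_assign_eq; last exact: leqnn.
  by rewrite /= !update_scons.
by [].
Qed.

Lemma solver_restrict (Rel : forall I : csp F k p, (nvars I).-tuple 'I_p -> Prop) :
  solver sz Rel ->
  solver sz (fun (I : csp F k q) x => exists2 y : (nvars I).-tuple 'I_p,
    x = map_tuple f y & Rel (restrict_csp I) y).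
Proof.
move=> [prog [a0 P0]].
have [a boundP] : poly_bounded (restrict_bound a0).
  rewrite /restrict_bound.
  by repeat poly_step.
exists (restrict_cmd prog), a => I.
have [sA [tA [y [execA tA_le sA0 rel]]]] := P0 (restrict_csp I).
have n_le := nvars_le_size sz I; have m_le := size_constraints_le sz I.
have size_le := restrict_csp_size I.
set N := data_size sz (enc_csp I) in boundP n_le m_le size_le *.
suff [s s0 [t exect t_le]] : exists2 s, s 0%N = enc_solution F (map_tuple f y) &
    runs sz (restrict_cmd prog) (input_store (enc_csp I)) s (restrict_bound a0 N).
  exists s, t, (map_tuple f y); split=> //; first exact: leq_trans (boundP N).
  by exists y.
have runA : runs sz prog (input_store (enc_csp (restrict_csp I))) sA
    (a0 * (size_factor * N) ^ a0 + a0).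
  exists tA => //; apply: leq_trans tA_le _; rewrite leq_add2r leq_mul2l.
  by case: (a0) => // a1; rewrite leq_exp2r ?size_le ?orbT.
set l := [:: enc_csp I; leaf;
  enc_seq [seq enc_constraint c | c <- constraints (restrict_csp I)];
  leaf; leaf; leaf; leaf; leaf].
have {}runA := runs_shift l runA.
rewrite input_storeE /= in runA.
have out : sA 0%N = enc_seq [seq enc_nat F j | j : 'I_p <- y] := sA0.
eexists; last first.
  apply: runs_leq.
    rewrite input_storeE; do 8 rewrite {1}empty_storeE.
    apply: runs_assign_seq; rewrite /= !update_scons.
    apply: runs_seq; first exact: runs_restrict_constraints.
    apply: runs_assign_seq; rewrite /= !update_scons.
    apply: runs_seq; first exact: runA.
    do 2 (apply: runs_assign_seq; rewrite /= !update_scons).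
    rewrite out.
    apply: runs_seq; first exact: runs_embed_solution.
    apply: runs_assign_seq; rewrite /= !update_scons.
    exact: runs_rev.
  set B := restrict_bound a0 N; rewrite /= size_map size_rev size_tuple.
  have bound1 m c : (m <= N -> m.+1 * c <= N.+1 * c)%N by move=> mN; rewrite leq_mul2r ltnS mN orbT.
  have := bound1 _ (2 + restrict_constraint_bound)%N m_le.
  have := bound1 _ 12 n_le; rewrite [nvars _]/=.
  rewrite /B /restrict_bound; set C := (2 + (50 + _ + _))%N.
  have := bound1 _ C n_le.
  move: (_ * C)%N (_ * C)%N (_ * (2 + _))%N (_ * (2 + _))%N (_ ^ a0)%N => b1 b2 b3 b4 b5.
  by lia.
by rewrite /= -map_rev revK /enc_solution [in RHS]/= -map_comp.
Qed.

End RestrictionProgram.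

(** * Cost of numbers *)

Lemma tame_unit_cost (F : realFieldType) : tame (fun _ : F => 1%N) 1.
Proof. by split=> *; lia. Qed.

Lemma bit_length_leq n m : (0 < m)%N -> (n < 2 ^ m)%N -> (bit_length n <= m)%N.
Proof.
move=> m_gt0 n_lt; rewrite /bit_length; case: (posnP n) => [->|n_gt0].
  by rewrite trunc_log0.
rewrite -(ltn_exp2l _ _ (isT : 1 < 2)%N); apply: leq_ltn_trans n_lt.
exact: trunc_logP.
Qed.

Lemma bit_length_gt n : (n < 2 ^ bit_length n)%N.
Proof. exact: trunc_log_ltn. Qed.

Lemma bit_length_homo n m : (n <= m)%N -> (bit_length n <= bit_length m)%N.
Proof.
by move=> nm; apply: bit_length_leq => //; apply: leq_ltn_trans nm (bit_length_gt m).
Qed.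

Lemma bit_length_mul n m : (bit_length (n * m) <= bit_length n + bit_length m)%N.
Proof.
apply: bit_length_leq => //; rewrite expnD.
by apply: ltn_mul; exact: bit_length_gt.
Qed.

Lemma frac_leq (a b : int) : b != 0 ->
  (`|numq (a%:~R / b%:~R)| <= `|a|)%N /\ (`|denq (a%:~R / b%:~R)| <= `|b|)%N.
Proof.
case: divqP => [|c x c0 _]; first by rewrite eqxx.
by rewrite !abszM !leq_pmull // absz_gt0.
Qed.

(** Without reduction to lowest terms, the sum of a list of fractions has the
    product of the denominators as denominator, and a numerator whose bit length
    also grows by at most [(rat_bit_size x).+1] for each [x]; reducing to lowest
    terms only makes both smaller. *)
Lemma tame_rat_bit_size : tame rat_bit_size 2.
Proof.
split=> [m|u v|s].
- rewrite /rat_bit_size -[m%:R]/(m%:Z%:~R) numq_int denq_int.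
  have : (bit_length m <= m.+1)%N.
    apply: bit_length_leq => //; apply: leq_trans (ltn_expl m (isT : 1 < 2)%N) _.
    by rewrite leq_pexp2l.
  have -> : bit_length `|1%Z| = 1%N by [].
  by rewrite absz_nat; lia.
- have uvE : u * v = (numq u * numq v)%:~R / (denq u * denq v)%:~R.
    by rewrite !rmorphM /= invfM mulrACA !divq_num_den.
  have den0 : denq u * denq v != 0 by rewrite mulf_neq0 ?denq_neq0.
  have [num_le den_le] := frac_leq (numq u * numq v) den0.
  rewrite uvE /rat_bit_size.
  apply: leq_trans (leq_add (bit_length_homo num_le) (bit_length_homo den_le)) _.
  rewrite !abszM; have := bit_length_mul `|numq u| `|numq v|.
  have := bit_length_mul `|denq u| `|denq v|; lia.
set S := (\sum_(u <- s) _)%N.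
have [a [b [b0 sE a_le b_le]]] : exists a b : int, [/\ b != 0,
    \sum_(u <- s) u = a%:~R / b%:~R, (`|a| <= 2 ^ S)%N & (`|b| <= 2 ^ S)%N].
  rewrite /S; elim: s {S} => [|x s [a [b [b0 sE a_le b_le]]]].
    by exists 0, 1; rewrite !big_nil mul0r.
  exists (numq x * b + a * denq x), (denq x * b).
  rewrite !big_cons sE; set S := (\sum_(u <- s) _)%N in a_le b_le *.
  have num_lt := ltnW (bit_length_gt `|numq x|).
  have den_lt := ltnW (bit_length_gt `|denq x|).
  have szE : rat_bit_size x = (bit_length `|numq x| + bit_length `|denq x|)%N by [].
  rewrite szE expnD expnS expnD.
  split.
  - by rewrite mulf_neq0 ?denq_neq0.
  - rewrite -{1}[x]divq_num_den addf_div ?intr_eq0 ?denq_neq0 //.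
    by rewrite !(rmorphD, rmorphM) /= .
  - have tri (y z : int) : (`|(y + z)%R| <= `|y| + `|z|)%N by lia.
    apply: leq_trans (tri _ _) _; rewrite !abszM.
    apply: leq_trans (leq_add (leq_mul num_lt b_le) (leq_mul a_le den_lt)) _.
    have := expn_gt0 2 (bit_length `|numq x|); have := expn_gt0 2 (bit_length `|denq x|).
    move: (2 ^ _)%N (2 ^ _)%N (2 ^ _)%N => y z t y0 z0; nia.
  - rewrite abszM; apply: leq_trans (leq_mul den_lt b_le) _.
    have := expn_gt0 2 (bit_length `|numq x|).
    move: (2 ^ _)%N (2 ^ _)%N (2 ^ _)%N => y z t y0; nia.
rewrite sE; have [num_le den_le] := frac_leq a b0.
have bl n : (n <= 2 ^ S)%N -> (bit_length n <= S.+1)%N.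
  by move=> nS; apply: bit_length_leq => //; apply: leq_ltn_trans nS _; rewrite ltn_exp2l.
have := bl _ (leq_trans num_le a_le); have := bl _ (leq_trans den_le b_le).
rewrite /rat_bit_size; move: (bit_length _) (bit_length _) => x y; lia.
Qed.

(** * The approximation factor *)

Lemma le_gamma (R : realFieldType) (k p q : nat) : (2 <= k)%N -> (p < q)%N ->
  2 * (k`!)%:R / (2 * q - 2 * p + k)%N%:R ^+ k <= gamma R k p q.
Proof.
move=> k2 pq; rewrite /gamma -/(nb_signed (q - p + k) k) natr1 -natrX.
have le_pow := @nb_signed_le (q - p + k) k ltac:(lia).
rewrite (_ : 2 * (q - p + k) - k = 2 * q - 2 * p + k)%N in le_pow; last by lia.
have pow_gt0 : (0 < (2 * q - 2 * p + k) ^ k)%N by rewrite expn_gt0; lia.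
rewrite -mulrA ler_pM2l ?ltr0n //.
rewrite ler_pdivrMr ?ltr0n // mulrC ler_pdivlMr ?ltr0n //.
by rewrite -natrM ler_nat mulnC -addn1.
Qed.

Lemma gammaE (R : realFieldType) (k p q : nat) :
  gamma R k p q = 2 / (nb_signed (q - p + k) k + 1)%:R.
Proof. by rewrite natrD. Qed.

Lemma gamma_le_diff_ratio (F : realFieldType) k p n (I : csp F k n.+1)
    (x : (nvars I).-tuple 'I_n.+1) :
    (1 <= k <= p)%N -> (p <= n.+1)%N -> opt I != wor I -> best_with_at_most p x ->
  gamma F k p n.+1 <= diff_ratio x.
Proof.
move=> kp pn /opt_gt_wor opt_wor /(ratio_few_symbols kp pn) ratio.
rewrite gammaE diff_ratioE ler_pdivlMr ?subr_gt0 // mulrAC.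
rewrite ler_pdivrMr; last by rewrite ltr0n addn1.
by rewrite [leRHS]mulrC.
Qed.

Lemma exists_best (F : realFieldType) k p n (I : csp F k n.+1) : (0 < p)%N ->
  exists x : (nvars I).-tuple 'I_n.+1, best_with_at_most p x.
Proof.
move=> p0; pose x0 := nseq_tuple (nvars I) (ord0 : 'I_n.+1).
have x0p : (nb_distinct x0 <= p)%N.
  apply: leq_trans p0; rewrite /nb_distinct.
  apply: (@uniq_leq_size _ _ [:: ord0]); first exact: undup_uniq.
  by move=> i; rewrite mem_undup => /nseqP[-> _]; rewrite mem_head.
pose v (x : (nvars I).-tuple 'I_n.+1) := goal_sign I * value x.
case: (@Order.TotalTheory.arg_maxP _ _ _ x0 (fun x => nb_distinct x <= p)%N v x0p) => x xp x_max.
by exists x; split=> // y yp; rewrite at_least_as_goodE; exact: x_max.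
Qed.

Lemma few_symbols_map n p m (x : m.-tuple 'I_n.+1) : (size (undup x) <= p.+1)%N ->
  exists (f : {ffun 'I_p.+1 -> 'I_n.+1}) (z : m.-tuple 'I_p.+1), x = map_tuple f z.
Proof.
move=> xp; exists [ffun i : 'I_p.+1 => nth ord0 (undup x) i].
exists (map_tuple (fun v => inord (index v (undup x))) x).
apply: eq_from_tnth => i; rewrite !tnth_map ffunE.
have xi : tnth x i \in undup x by rewrite mem_undup mem_tnth.
by rewrite inordK ?nth_index //; apply: leq_trans xp; rewrite index_mem.
Qed.

(** * Transferring the approximation guarantee *)

Section Reduction.
Variables (F R : realFieldType) (iota : {rmorphism F -> R}) (sz : F -> nat) (c0 : nat).
Hypothesis iota_mono : {mono iota : x y / x <= y}.
Hypothesis tame_sz : tame sz c0.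

(** The transfer of the guarantee, on numbers only: [v_f] is the value found on the
    restriction, of extreme values [opt_f] and [wor_f], [v] the value finally
    returned, and [best] that of the best solution with few symbols, which the
    restriction captures.  From [v_f - wor_f >= rho * (opt_f - wor_f)] and
    [rho <= 1] one gets the same inequality with [wor] instead of [wor_f], because
    [wor_f >= wor]. *)
Lemma restricted_ratio (a : nat) (rho : R) (opt wor v opt_f wor_f v_f best : F) :
    rho <= 1 -> wor < opt -> wor <= v -> v_f <= v -> best <= opt_f -> v_f <= opt_f ->
    wor_f <= v_f -> wor <= wor_f ->
    (opt_f != wor_f -> rho <= iota ((v_f - wor_f) / (opt_f - wor_f))) ->
    2 * (opt - wor) <= (a + 1)%:R * (best - wor) ->
  2 / (a + 1)%:R * rho <= iota ((v - wor) / (opt - wor)).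
Proof.
move=> rho_le1 wor_opt wor_v vf_v best_optf vf_optf worf_vf wor_worf rho_le best_le.
have iota_gt0 u : (0 < iota u) = (0 < u).
  by rewrite -{1}(rmorph0 iota) (leW_mono iota_mono).
have a_gt0 : 0 < (a + 1)%:R :> R by rewrite ltr0n addn1.
have opt_gt0 : 0 < iota (opt - wor) by rewrite iota_gt0 subr_gt0.
have [rho_le0|rho_gt0] := leP rho 0.
  apply: (@le_trans _ _ 0); first by rewrite pmulr_rle0 // divr_gt0.
  by rewrite -(rmorph0 iota) iota_mono divr_ge0 ?subr_ge0 // ltW.
have key : rho * iota (opt_f - wor) <= iota (v - wor).
  have iota_v : iota (v_f - wor) <= iota (v - wor) by rewrite iota_mono lerD2r.
  apply: le_trans iota_v; have [optf_worf|optf_worf] := eqVneq opt_f wor_f.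
    have -> : v_f = opt_f by apply/eqP; rewrite eq_le vf_optf optf_worf.
    rewrite ler_piMl // -(rmorph0 iota) iota_mono subr_ge0.
    exact: le_trans (le_trans wor_worf worf_vf) vf_optf.
  have optf_gt0 : 0 < opt_f - wor_f.
    by rewrite subr_gt0 lt_def optf_worf (le_trans worf_vf).
  move: (rho_le optf_worf); rewrite fmorph_div ler_pdivlMr ?iota_gt0 // => rho_vf.
  have worf_ge0 : 0 <= iota (wor_f - wor) by rewrite -(rmorph0 iota) iota_mono subr_ge0.
  have -> : opt_f - wor = (opt_f - wor_f) + (wor_f - wor) by rewrite addrA subrK.
  have -> : v_f - wor = (v_f - wor_f) + (wor_f - wor) by rewrite addrA subrK.
  rewrite (rmorphD iota (opt_f - wor_f)) (rmorphD iota (v_f - wor_f)) mulrDr.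
  by apply: lerD rho_vf _; rewrite ler_piMl.
have opt_le : 2 * iota (opt - wor) <= (a + 1)%:R * iota (opt_f - wor).
  rewrite -[2](rmorph_nat iota) -[(a + 1)%:R](rmorph_nat iota) -!rmorphM iota_mono.
  by apply: le_trans best_le _; rewrite ler_pM2l ?ltr0n ?addn1 // lerD2r.
rewrite fmorph_div ler_pdivlMr //; apply: le_trans key.
rewrite mulrAC [leLHS]mulrC ler_pM2l // mulrAC ler_pdivrMr // [leRHS]mulrC.
exact: opt_le.
Qed.

Lemma solver_weaken k q (Rel1 Rel2 : forall I : csp F k q, (nvars I).-tuple 'I_q -> Prop) :
  (forall I x, Rel1 I x -> Rel2 I x) -> solver sz Rel1 -> solver sz Rel2.
Proof.
move=> Rel12 [prog [a P1]]; exists prog, a => I.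
by have [s [t [x [? ? ? /Rel12 ?]]]] := P1 I; exists s, t, x.
Qed.

Lemma solver_best_restriction k p q (Rel : forall I : csp F k p, (nvars I).-tuple 'I_p -> Prop)
    f0 (fs : seq {ffun 'I_p -> 'I_q}) : solver sz Rel ->
  solver sz (fun (I : csp F k q) x => {in f0 :: fs, forall f : {ffun 'I_p -> 'I_q},
    exists2 y : (nvars I).-tuple 'I_p, at_least_as_good x (map_tuple f y) &
      Rel (restrict_csp f I) y}).
Proof.
have agood_refl (I : csp F k q) (x : (nvars I).-tuple 'I_q) : at_least_as_good x x.
  by rewrite /at_least_as_good; case: maximizing.
have agood_trans (I : csp F k q) (x y z : (nvars I).-tuple 'I_q) :
    at_least_as_good x y -> at_least_as_good y z -> at_least_as_good x z.
  rewrite /at_least_as_good; case: (maximizing I) => xy yz.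
    exact: le_trans yz xy.
  exact: le_trans xy yz.
move=> sol; elim: fs f0 => [|f1 fs IHfs] f0.
  apply: solver_weaken (solver_restrict tame_sz f0 sol) => I x [y -> rel] f.
  by rewrite inE => /eqP->; exists y.
apply: solver_weaken (solver_best tame_sz (solver_restrict tame_sz f0 sol) (IHfs f1)).
move=> I x [_ [x2 [[y -> rel] rel2 good1 good2]]] f; rewrite inE => /predU1P[->|ffs].
  by exists y.
have [z good rel'] := rel2 f ffs; exists z => //; exact: agood_trans good2 good.
Qed.

(** No solution of an instance with two distinct values has a ratio above 1. *)
Lemma approximable_le1 k p rho :
  (1 <= k)%N -> approximable iota sz k p.+2 rho -> rho <= 1.
Proof.
move=> k1 [prog [a apx]].
have bounds : (1 <= 1 <= minn k 1)%N by rewrite leq_min k1.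
pose c : constraint F k p.+2 1 := @Constraint F k p.+2 1 1 1 [tuple ord0]
  (fun t => (tnth t ord0)%:R) ltr01 bounds erefl.
pose I : csp F k p.+2 := @Csp F k p.+2 1 true [:: c] erefl erefl.
have valueE (v : 'I_p.+2) : value (I := I) [tuple v] = v%:R.
  by rewrite /value big_seq1 mul1r; congr (_%:R); rewrite tnth_map tnth0.
have opt_wor : opt I != wor I.
  apply/negP => /eqP E.
  (* The symbols 0 and 1 give the values 0 and 1. *)
  have v0 := valueE ord0; have v1 := valueE (lift ord0 ord0).
  have := @goal_sign_opt _ _ _ I [tuple lift ord0 ord0].
  have := @goal_sign_wor _ _ _ I [tuple ord0].
  rewrite E v0 v1 /goal_sign /= !mul1r => w0 w1.
  by have := le_trans w1 w0; rewrite ler_nat.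
have [s [t [x [_ _ _ /(_ opt_wor) rho_le]]]] := apx I.
apply: le_trans rho_le _; rewrite -(rmorph1 iota) iota_mono diff_ratioE.
rewrite ler_pdivrMr ?subr_gt0 ?opt_gt_wor // [leRHS]mul1r lerD2r; exact: goal_sign_opt.
Qed.

(** All maps [f] are tried.  The map [f0] only makes the list of maps visibly
    nonempty, as [solver_best_restriction] requires. *)
Theorem approximable_more_symbols k p q rho :
    (2 <= k)%N -> (k <= p)%N -> (p < q)%N ->
  approximable iota sz k p rho ->
  approximable iota sz k q (gamma R k p q * rho).
Proof.
case: p q => [|[|p]] [|n] k2 kp pn apx; try lia.
have k1 : (1 <= k)%N by lia.
have rho_le1 := approximable_le1 k1 apx.
pose f0 : {ffun 'I_p.+2 -> 'I_n.+1} := [ffun=> ord0].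
suff better : forall (I : csp F k n.+1) x,
    {in f0 :: enum {: {ffun 'I_p.+2 -> 'I_n.+1}}, forall f : {ffun 'I_p.+2 -> 'I_n.+1},
      exists2 y : (nvars I).-tuple 'I_p.+2, at_least_as_good x (map_tuple f y) &
        opt (restrict_csp f I) != wor (restrict_csp f I) ->
        rho <= iota (diff_ratio (I := restrict_csp f I) y)} ->
    opt I != wor I -> gamma R k p.+2 n.+1 * rho <= iota (diff_ratio x).
  exact: solver_weaken better (solver_best_restriction _ _ apx).
move=> I x x_good opt_wor.
have OW : goal_sign I * wor I < goal_sign I * opt I by exact: opt_gt_wor.
have xW := goal_sign_wor x.
have [xb xb_best] := exists_best I (isT : (0 < p.+2)%N).
have [f [z xbE]] := few_symbols_map (proj1 xb_best).
have [|y xy y_rho] := x_good f; first by rewrite inE mem_enum orbT.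
pose If := restrict_csp f I.
have k1p : (1 <= k <= p.+2)%N by rewrite k1.
have := ratio_few_symbols k1p (ltnW pn) xb_best.
rewrite at_least_as_goodE -(value_restrict f) in xy.
rewrite xbE -(value_restrict f).
have Of_z : goal_sign I * value (I := If) z <= goal_sign I * opt If := goal_sign_opt (I := If) z.
have y_Of : goal_sign I * value (I := If) y <= goal_sign I * opt If := goal_sign_opt (I := If) y.
have Wf_y : goal_sign I * wor If <= goal_sign I * value (I := If) y := goal_sign_wor (I := If) y.
have W_Wf : goal_sign I * wor I <= goal_sign I * wor If.
  have [y' -> _] := worP If; rewrite (value_restrict f); exact: goal_sign_wor.
rewrite -/If in xy *; move: y_rho; rewrite !diff_ratioE.
have -> : goal_sign (restrict_csp f I) = goal_sign I by [].
rewrite gammaE.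
have -> : (opt If == wor If) = (goal_sign I * opt If == goal_sign I * wor If).
  by rewrite (can_eq (@goal_signK _ _ _ I)).
exact: restricted_ratio.
Qed.

End Reduction.

Theorem corollary3p1 (R : realType) (k p q : nat)
    (hk : (2 <= k)%N) (hp : (k <= p)%N) (hq : (p < q)%N) :
  [/\ (forall I : csp R k q, opt I != wor I ->
         forall x : (nvars I).-tuple 'I_q,
           best_with_at_most p x -> gamma R k p q <= diff_ratio x),
      2 * (k`!)%:R / (2 * q - 2 * p + k)%N%:R ^+ k <= gamma R k p q,
      (forall rho : R, approximable_rat k p rho ->
         approximable_rat k q (gamma R k p q * rho))
    & (forall rho : R, approximable_real k p rho ->
         approximable_real k q (gamma R k p q * rho))].
Proof.
split.
- case: q hq => // n hq I opt_wor x; apply: gamma_le_diff_ratio => //; last exact: ltnW.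
  by rewrite hp andbT; exact: ltnW.
- exact: le_gamma.
- move=> rho; exact: (@approximable_more_symbols rat R (ratr : {rmorphism rat -> R}) _ _
    (@ler_rat R) tame_rat_bit_size).
- move=> rho.
  exact: (approximable_more_symbols (iota := idfun) (fun _ _ => erefl) (tame_unit_cost R)).
Qed.
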